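(* Let $r\ge s$ be positive integers, let $S=RT_{r,s}$ be the right trapezoid with left border $L$, and let $m'\lessdot m$ and $M'\lessdot M$ be elements of $S$ such that $se(m)=ne(M')=\varnothing$. (a) The bijection $\aleph\colon U_S\to D_S$ restricts to a bijection from $U_S(\mathscr C^L_{m,M})$ to $D_S(\mathscr C^L_{m',M'})$. (b) Let $x\in\mathbb R_+^S$ and $z=\tilde\rho^{-1}(x)$. Then $w_{\mathscr C^L_{m,M}}(x)=w_{\mathscr C^L_{m',M'}}(z)$.
   Context: Notation: $\mathbb R_+$ is the positive reals, $[n]=\{1,\dots,n\}$, $\lessdot$ denotes cover relations. For a collection $\mathscr C$ of chains, $w_{\mathscr C}(x)=\sum_{C\in\mathscr C}\prod_{p\in C}x_p$. The right trapezoid is $RT_{r,s}=\{(i,j)\in[r+s-1]\times[s]: i-j<r\}$ with the componentwise order; its left border is $L=\{(\ell+r-1,\ell):1\le\ell\le s\}$. Antichain rowmotion on $S$: the toggle $\tau_p\colon\mathbb R_+^S\to\mathbb R_+^S$ replaces $x_p$ by $\left(\sum_{C}\prod_{q\in C}x_q\right)^{-1}$, $C$ ranging over all maximal chains of $S$ containing $p$, and fixes other coordinates; $\tilde\rho=\tau_{\lambda^{-1}(n)}\circ\cdots\circ\tau_{\lambda^{-1}(1)}$ for any linear extension $\lambda\colon S\to[n]$ (a bijection independent of $\lambda$). Arborescences: let $\widehat S$ be $S$ with a new minimum $\hat0$ and new maximum $\hat1$. An upward arborescence of $S$ is a subgraph of the Hasse diagram of $\widehat S\setminus\{\hat1\}$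 containing, for each $p\in S$, exactly one edge joining $p$ to an element covered by $p$. A downward arborescence is a subgraph of the Hasse diagram of $\widehat S\setminus\{\hat0\}$ containing, for each $p\in S$, exactly one edge joining $p$ to an element covering $p$. $U_S$, $D_S$ are the sets of upward and downward arborescences. For a saturated chain $C$ in $S$, $U_S(C)$ (resp. $D_S(C)$) is the set of those upward (resp. downward) arborescences containing all edges (cover relations) of $C$; for a collection $\mathscr C$ of chains with common minimum and maximum, $U_S(\mathscr C)=\bigsqcup_{C\in\mathscr C}U_S(C)$ and $D_S(\mathscr C)=\bigsqcup_{C\in\mathscr C}D_S(C)$. The bijection $\aleph\colon U_S\to D_S$: regard the Hasse diagram of $S$ as drawn in $\mathbb R^2$ with vertices at the points $(i,j)$ and edges as unit segments. For $T\in U_S$, let $\overline T$ be the translate by $(-\frac12,-\frac12)$ of the edges of $T$ joining elements of $S$. Then $\aleph(T)$ consists of all edges of the Hasse diagram of $S$ that do not intersect $\overline T$, together with all forced edges, i.e. all edges $p\lessdot q$ of $\widehat S$ with $p\in S$ such that $q$ is the only element of $\widehat S$ covering $p$. Directions: for $p=(i,j)\in S$, $se(p)$ is the set of elements of $S$ of the form $(i-1-k,j+k)$ with $k\ge0$; $sw(p)$ is the set of elements of $S$ of the form $(i-1-k,j+k)$ with $k<0$; $ne(p)=\{q\in S:p\in sw(q)\}$. $\mathscr C_{p,q}$ is the set of all saturated chains in $S$ with minimum $p$ and maximum $q$ (a single one-element chain if $p=q$, empty if $p\not\le q$), and $\mathscr C^L_{p,q}\subseteq\mathscr C_{p,q}$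 is the subset of chains that intersect $L$. *)

(* Defs.v *)
From HB Require Import structures.
From mathcomp Require Import all_boot all_order all_algebra.
From mathcomp Require Import all_classical all_reals.

Set Implicit Arguments.
Unset Strict Implicit.
Unset Printing Implicit Defensive.

Import Order.TTheory GRing.Theory Num.Theory.
Local Open Scope order_scope.

Definition covers d (S : finPOrderType d) (p q : S) : bool :=
  (p < q) && [forall z : S, ~~ (p < z < q)].

Definition is_chain d (S : finPOrderType d) (C : {set S}) : bool :=
  [forall p in C, forall q in C, p >=< q].

Definition saturated d (S : finPOrderType d) (C : {set S}) : bool :=
  is_chain C &&
  [forall p in C, forall q in C,
     ((p < q) && [forall z in C, ~~ (p < z < q)]) ==> covers p q].

Definition chains_between d (S : finPOrderType d) (p q : S) : {set {set S}} :=
  [set C : {set S} |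
     [&& saturated C, p \in C, q \in C & [forall z in C, p <= z <= q]]]%SET.

Definition chain_weight d (S : finPOrderType d) (R : realType)
    (CC : {set {set S}}) (x : {ffun S -> R}) : R :=
  (\sum_(C in CC) \prod_(p in C) x p)%R.

Definition positive_labeling d (S : finPOrderType d) (R : realType)
    (x : {ffun S -> R}) : Prop :=
  forall p : S, (0 < x p)%R.

Definition toggle d (S : finPOrderType d) (R : realType) (p : S)
    (x : {ffun S -> R}) : {ffun S -> R} :=
  [ffun q => if q == p then
     (chain_weight [set C | maxset (@is_chain d S) C & p \in C]%SET x)^-1%R
   else x q].

(* [laminv] is the inverse of [lam]; the labels are 0, ..., #|S| - 1. *)
Definition linear_extension d (S : finPOrderType d)
    (lam : S -> 'I_#|S|) (laminv : 'I_#|S| -> S) : Prop :=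
  [/\ cancel lam laminv, cancel laminv lam &
      forall p q : S, p <= q -> (lam p <= lam q)%N].

(* [foldl] applies the toggle at [laminv 0] first. *)
Definition rowmotion d (S : finPOrderType d) (R : realType)
    (laminv : 'I_#|S| -> S) (x : {ffun S -> R}) : {ffun S -> R} :=
  foldl (fun y k => toggle (laminv k) y) x (enum 'I_#|S|).

Definition hat (S : Type) : Type := option (option S).
Definition hbot {S : Type} : hat S := None.
Definition htop {S : Type} : hat S := Some None.
Definition inhat {S : Type} (p : S) : hat S := Some (Some p).

HB.instance Definition _ (S : finType) := Finite.on (hat S).

Definition hat_le d (S : finPOrderType d) (a b : hat S) : bool :=
  match a, b with
  | None, _ => true
  | _, Some None => true
  | Some (Some p), Some (Some q) => p <= q
  | _, _ => false
  end.

Lemma hat_le_refl d (S : finPOrderType d) : reflexive (@hat_le d S).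
Proof. by case=> [[p|]|] //=. Qed.

Lemma hat_le_anti d (S : finPOrderType d) : antisymmetric (@hat_le d S).
Proof. by case=> [[p|]|] [[q|]|] //= /le_anti ->. Qed.

Lemma hat_le_trans d (S : finPOrderType d) : transitive (@hat_le d S).
Proof. by case=> [[p|]|] [[q|]|] [[z|]|] //=; apply: le_trans. Qed.

HB.instance Definition _ d (S : finPOrderType d) :=
  Order.Le_isPOrder.Build d (hat S)
    (@hat_le_refl d S) (@hat_le_anti d S) (@hat_le_trans d S).

(* An edge is a pair (lower end, upper end) of elements of [hat S]. *)
Notation edge S := (hat S * hat S)%type.

Definition up_arborescences d (S : finPOrderType d) : {set {set edge S}} :=
  [set T : {set edge S} |
     [forall e in T, [&& covers e.1 e.2, e.1 != htop & e.2 != htop]] &&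
     [forall p : S, #|[set e in T | e.2 == inhat p]| == 1%N]]%SET.

Definition down_arborescences d (S : finPOrderType d) : {set {set edge S}} :=
  [set T : {set edge S} |
     [forall e in T, [&& covers e.1 e.2, e.1 != hbot & e.2 != hbot]] &&
     [forall p : S, #|[set e in T | e.1 == inhat p]| == 1%N]]%SET.

Definition chain_edges d (S : finPOrderType d) (C : {set S}) : {set edge S} :=
  [set (inhat p, inhat q) | p in C, q in C & covers p q]%SET.

(* For a collection of saturated chains with common minimum and maximum, the
   unions below are disjoint: an upward arborescence contains at most one
   saturated chain descending from a given element to another given one, and
   dually for downward arborescences. *)
Definition up_arb_containing d (S : finPOrderType d) (CC : {set {set S}}) :
    {set {set edge S}} :=
  (\bigcup_(C in CC)
     [set T in up_arborescences S | chain_edges C \subset T])%SET.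

Definition down_arb_containing d (S : finPOrderType d) (CC : {set {set S}}) :
    {set {set edge S}} :=
  (\bigcup_(C in CC)
     [set T in down_arborescences S | chain_edges C \subset T])%SET.

(* Ordinals are 0-based: the pair (i0, j0) below stands for the point
   (i, j) = (i0 + 1, j0 + 1), and i - j < r amounts to i0 < j0 + r. *)
Definition in_RT (r s : nat) (p : 'I_(r + s - 1) *p 'I_s) : bool :=
  (p.1 < p.2 + r)%N.

Record RT (r s : nat) : Type := MkRT {
  RT_val : 'I_(r + s - 1) *p 'I_s;
  RT_valP : in_RT RT_val }.

Fact RT_display : Order.disp_t. Proof. exact: (Order.Disp tt tt). Qed.

HB.instance Definition _ r s := [isSub of RT r s for @RT_val r s].
HB.instance Definition _ r s := [Finite of RT r s by <:].
HB.instance Definition _ r s :=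
  [SubChoice_isSubPOrder of RT r s by <: with RT_display].

Definition ci r s (p : RT r s) : nat := (RT_val p).1.+1.
Definition cj r s (p : RT r s) : nat := (RT_val p).2.+1.

Definition left_border r s : {set RT r s} :=
  [set p | [exists l : 'I_s.+1,
     [&& (1 <= l)%N, ci p == (l + r - 1)%N & cj p == l]]]%SET.

Definition chains_L r s (p q : RT r s) : {set {set RT r s}} :=
  [set C in chains_between p q | ~~ [disjoint C & left_border r s]]%SET.

Definition se r s (p : RT r s) : set (RT r s) :=
  [set q | exists k : int, [/\ (0 <= k)%R,
     ((ci q)%:Z = (ci p)%:Z - 1 - k)%R & ((cj q)%:Z = (cj p)%:Z + k)%R]]%classic.

Definition sw r s (p : RT r s) : set (RT r s) :=
  [set q | exists k : int, [/\ (k < 0)%R,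
     ((ci q)%:Z = (ci p)%:Z - 1 - k)%R & ((cj q)%:Z = (cj p)%:Z + k)%R]]%classic.

Definition ne r s (p : RT r s) : set (RT r s) := [set q | sw q p]%classic.

Definition drawn_at (R : realType) r s (p : RT r s) : R * R :=
  ((ci p)%:R, (cj p)%:R)%R.

Definition segment (R : realType) (a b : R * R) : set (R * R) :=
  [set (line_path a.1 b.1 t, line_path a.2 b.2 t) | t in `[0%R, 1%R]]%classic.

Definition shifted (R : realType) (A : set (R * R)) : set (R * R) :=
  [set (v.1 - 2^-1, v.2 - 2^-1)%R | v in A]%classic.

Definition shifted_drawing (R : realType) r s (T : {set edge (RT r s)}) :
    set (R * R) :=
  shifted [set v | exists p q : RT r s,
    (inhat p, inhat q) \in T /\ segment (drawn_at R p) (drawn_at R q) v]%classic.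

Definition forced_edges d (S : finPOrderType d) : {set edge S} :=
  [set e : edge S | [exists p : S, (e.1 == inhat p) &&
     ([set q : hat S | covers (inhat p) q] == [set e.2])]]%SET.

Definition aleph (R : realType) r s (T : {set edge (RT r s)}) :
    {set edge (RT r s)} :=
  ([set e : edge (RT r s) | [exists p : RT r s, exists q : RT r s,
      [&& e == (inhat p, inhat q), covers p q &
          `[< (segment (drawn_at R p) (drawn_at R q) `&` shifted_drawing T
                 = set0)%classic >]]]]
   :|: forced_edges (RT r s))%SET.

(* Main.v *)
Require Import Defs.
From mathcomp Require Import all_boot all_order all_algebra.
From mathcomp Require Import all_classical all_reals.
From mathcomp Require Import zify lra ring.

(** Part (a) is planar duality.  Translating the edges of an upward arborescence
    T by (-1/2,-1/2) makes the walk down from M in T and the walk up from m' in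
    aleph(T) non-crossing, except at the forced edges of L; hence one walk meets
    L and then its target exactly when the other does.

    For (b), let a(p) be the total x-weight of the chains from the minimum to p;
    rowmotion says precisely that 1/a(p) is the total z-weight of the chains from
    p to the maximum.  Up to the common factor a(M)/a(m'), the two sides are then
    the probabilities that a random walk down from M, resp. up from m', reaches
    its target through L, where for every unit square one and the same parameter
    is the probability of a step in direction i down from its top and up from its
    bottom.  Both sides are affine in each parameter, and when all parameters are
    0 or 1 the equality is the duality used in (a). *)

(** One parameter per unit square suffices because of a reciprocity. Let q and q' be the middle
    corners of a square. A walk down from the top chooses q with probability a(q)/(a(q)+a(q')). A
    walk up from the bottom uses the weights 1/a, so it chooses q' with probability
    (1/a(q'))/(1/a(q)+1/a(q')), the same number; and the step down to q and the step up to q' run in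
    the same direction. The factor a(M)/a(m') comes from telescoping: x_p is a(p) divided by the sum
    of a over the elements covered by p, hence a ratio of successive values of a times a step
    probability. The conditions on m and M' put m on i = 1 and M' on j = s, so m covers only m', and
    only M covers M'. The duality is stated for two abstract step relations, since it serves both
    arborescences and the deterministic walks given by 0/1 parameters. No Jordan curve is involved:
    the side of a walk on which a point lies is recorded by a witness on that walk, which is updated
    at each step. *)

Set Implicit Arguments.
Unset Strict Implicit.
Unset Printing Implicit Defensive.

Import Order.TTheory GRing.Theory Num.Theory.
Local Open Scope order_scope.

(* Confines the import below, which gives the names of [finset] priority over
   their homonyms in [classical_sets]. *)
Section FiniteSetNames.
Import mathcomp.boot.fintype mathcomp.boot.finset.

(** * Saturated chains *)

Section Chains.
Context d (S : finPOrderType d).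
Implicit Types (p q y z : S) (C : {set S}).

Lemma covers_lt p q : covers p q -> p < q.
Proof. by case/andP. Qed.

Lemma coversP p q :
  reflect (p < q /\ forall z, p < z -> z < q -> False) (covers p q).
Proof.
apply: (iffP andP) => -[lt_pq H]; split=> //.
  by move=> z pz zq; move/forallP/(_ z): H; rewrite pz zq.
by apply/forallP=> z; apply/negP=> /andP[pz zq]; exact: (H z).
Qed.

Lemma is_chainP C : reflect {in C &, forall p q, p >=< q} (is_chain C).
Proof.
apply: (iffP forall_inP) => H p; last by move=> pC; apply/forall_inP=> q; apply: H.
by move=> q pC qC; move/forall_inP: (H p pC); apply.
Qed.

Lemma saturatedP C :
  reflect ({in C &, forall p q, p >=< q} /\
           {in C &, forall p q, p < q -> {in C, forall z, ~~ (p < z < q)} ->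
                                covers p q})
          (saturated C).
Proof.
apply: (iffP andP) => -[/is_chainP chC H]; split=> //.
  move=> p q pC qC pq Hz; move/forall_inP/(_ p pC)/forall_inP/(_ q qC): H.
  by move/implyP; apply; rewrite pq; apply/forall_inP.
apply/forall_inP=> p pC; apply/forall_inP=> q qC; apply/implyP=> /andP[pq Hz].
by apply: H => // z zC; move/forall_inP: Hz; apply.
Qed.

Lemma chains_betweenP p q C :
  reflect [/\ saturated C, p \in C, q \in C & {in C, forall z, p <= z <= q}]
          (C \in chains_between p q).
Proof.
rewrite inE; apply: (iffP and4P) => -[sC pC qC H]; split=> //.
  by move=> z; apply: (forall_inP H).
by apply/forall_inP.
Qed.

Lemma chain_comparable p q C :
  C \in chains_between p q -> {in C &, forall y z, y >=< z}.
Proof. by case/chains_betweenP=> /saturatedP[]. Qed.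

Lemma chain_pred p q C y :
    C \in chains_between p q -> y \in C -> y != p ->
  exists2 z, z \in C & covers z y.
Proof.
case/chains_betweenP=> /saturatedP[chC satC] pC qC bC yC neq_yp.
have lt_py : p < y by rewrite lt_neqAle eq_sym neq_yp; case/andP: (bC y yC).
have Pp : (p \in C) && (p < y) by rewrite pC.
(* A maximiser of [rk] among the elements of [C] strictly below [y] is the greatest of them, so
   saturation makes it covered by [y]. *)
pose rk z := #|[set w in C | w <= z]|.
case: (@arg_maxnP _ p (fun z => (z \in C) && (z < y)) rk Pp) => z /andP[zC zy] zmax.
exists z => //; apply: satC => // w wC; apply/negP=> /andP[zw wy].
have /zmax : (w \in C) && (w < y) by rewrite wC.
apply/negP; rewrite -ltnNge; apply: proper_card; apply/properP; split.
  by apply/subsetP=> u; rewrite !inE => /andP[-> /le_trans ->] //; apply: ltW.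
by exists w; rewrite !inE wC ?lexx //= lt_geF.
Qed.

Lemma chain_succ p q C y :
    C \in chains_between p q -> y \in C -> y != q ->
  exists2 z, z \in C & covers y z.
Proof.
case/chains_betweenP=> /saturatedP[chC satC] pC qC bC yC neq_yq.
have lt_yq : y < q by rewrite lt_neqAle neq_yq; case/andP: (bC y yC).
have Pq : (q \in C) && (y < q) by rewrite qC.
pose rk z := #|[set w in C | z <= w]|.
case: (@arg_maxnP _ q (fun z => (z \in C) && (y < z)) rk Pq) => z /andP[zC yz] zmax.
exists z => //; apply: satC => // w wC; apply/negP=> /andP[yw wz].
have /zmax : (w \in C) && (y < w) by rewrite wC.
apply/negP; rewrite -ltnNge; apply: proper_card; apply/properP; split.
  by apply/subsetP=> u; rewrite !inE => /andP[->]; apply: le_trans; apply: ltW.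
by exists w; rewrite !inE wC ?lexx //= lt_geF.
Qed.

Lemma chain_interval p q C y z :
    C \in chains_between p q -> y \in C -> z \in C -> y <= z ->
  [set u in C | y <= u <= z]%SET \in chains_between y z.
Proof.
case/chains_betweenP=> /saturatedP[chC satC] _ _ _ yC zC yz.
apply/chains_betweenP; split; rewrite ?inE ?yC ?zC ?yz ?lexx //; last first.
  by move=> u; rewrite inE => /andP[].
apply/saturatedP; split=> [u v|u v].
  by rewrite !inE => /andP[uC _] /andP[vC _]; apply: chC.
rewrite !inE => /andP[uC /andP[yu uz]] /andP[vC /andP[yv vz]] uv Huv.
apply: satC => // w wC; apply/negP=> /andP[uw wv]; move: (Huv w).
rewrite inE wC uw wv (le_trans yu (ltW uw)) (le_trans (ltW wv) vz).
by move=> /(_ isT).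
Qed.

Lemma chain_join p z q C1 C2 :
    C1 \in chains_between p z -> C2 \in chains_between z q ->
  (C1 :|: C2)%SET \in chains_between p q.
Proof.
case/chains_betweenP=> /saturatedP[chC1 satC1] pC1 zC1 bC1.
case/chains_betweenP=> /saturatedP[chC2 satC2] zC2 qC2 bC2.
have le12 u v : u \in C1 -> v \in C2 -> u <= v.
  by move=> /bC1/andP[_ uz] /bC2/andP[zv _]; apply: le_trans zv.
apply/chains_betweenP; split; rewrite ?inE ?pC1 ?qC2 ?orbT //; last first.
  move=> u; rewrite inE => /orP[uC|uC].
    by case/andP: (bC1 u uC) => -> /le_trans ->; rewrite ?le12.
  by case/andP: (bC2 u uC) => zu ->; rewrite le12.
apply/saturatedP; split=> [u v|u v]; rewrite !inE.
  case/orP=> uC /orP[] vC; [exact: chC1| | |exact: chC2].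
    by rewrite le_comparable // le12.
  by rewrite ge_comparable // le12.
case/orP=> uC /orP[] vC uv Huv.
- apply: satC1 => // w wC; apply: Huv; by rewrite inE wC.
- have [uz|neq_uz] := eqVneq u z.
    by apply: satC2; rewrite // ?uz // => w wC; rewrite -uz; apply: Huv; rewrite inE wC orbT.
  have [vz|neq_vz] := eqVneq v z.
    by apply: satC1; rewrite // ?vz // => w wC; rewrite -vz; apply: Huv; rewrite inE wC.
  have : ~~ (u < z < v) by apply: Huv; rewrite inE zC1.
  by rewrite !lt_neqAle neq_uz eq_sym neq_vz !le12.
- by move: (le12 _ _ vC uC); rewrite lt_geF.
- apply: satC2 => // w wC; apply: Huv; by rewrite inE wC orbT.
Qed.

Lemma chain_bounds p q C z : C \in chains_between p q -> z \in C -> p <= z <= q.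
Proof. by case/chains_betweenP=> _ _ _ H /H. Qed.

Lemma chain_ends p q C : C \in chains_between p q -> (p \in C) && (q \in C).
Proof. by case/chains_betweenP=> _ -> ->. Qed.

Lemma chains_between_refl p : chains_between p p = [set [set p]]%SET.
Proof.
apply/setP=> C; rewrite [RHS]inE; apply/idP/eqP=> [CC|->].
  apply/setP=> z; rewrite inE; apply/idP/eqP=> [/(chain_bounds CC)|->].
    by move=> /andP[pz zp]; apply/le_anti; rewrite zp.
  by case/andP: (chain_ends CC).
apply/chains_betweenP; split; rewrite ?inE //; last by move=> z; rewrite inE => /eqP->; rewrite lexx.
apply/saturatedP; split=> u v; rewrite !inE => /eqP-> /eqP->; first exact: comparablexx.
by rewrite ltxx.
Qed.

Lemma chains_between_cover p q : covers p q -> chains_between p q = [set [set p; q]]%SET.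
Proof.
move=> cpq; have lt_pq := covers_lt cpq.
apply/setP=> C; rewrite [RHS]inE; apply/idP/eqP=> [CC|->].
  apply/setP=> z; rewrite !inE; apply/idP/orP=> [/(chain_bounds CC)|].
    case/andP; rewrite !le_eqVlt => /orP[/eqP->|pz]; first by left.
    case/orP=> [/eqP->|zq]; first by right.
    by case/coversP: cpq => _ /(_ z pz zq).
  by case/andP: (chain_ends CC) => pC qC [/eqP->|/eqP->].
apply/chains_betweenP; split; rewrite ?inE ?eqxx ?orbT //; last first.
  by move=> z; rewrite !inE => /orP[] /eqP->; rewrite lexx ?(ltW lt_pq).
have le_pq := ltW lt_pq.
apply/saturatedP; split=> u v; rewrite !inE => /orP[]/eqP-> /orP[]/eqP-> //;
  rewrite ?comparablexx ?ltxx ?(le_comparable le_pq) ?(ge_comparable le_pq) ?(lt_gtF lt_pq) //.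
Qed.

(** Removing the top of a saturated chain leaves the interval that ends at its predecessor, because
    nothing in the chain lies between the two. *)
Lemma chain_ind_up p (P : S -> {set S} -> Prop) :
    P p [set p]%SET ->
    (forall y z C, C \in chains_between p y -> covers y z -> P y C ->
       P z (z |: C)%SET) ->
  forall q C, C \in chains_between p q -> P q C.
Proof.
move=> P0 PS q C; have [n] := ubnP #|C|; elim: n q C => // n IHn q C ltCn CC.
have [eq_qp|neq_qp] := eqVneq q p.
  by move: CC; rewrite eq_qp chains_between_refl inE => /eqP->.
have /andP[pC qC] := chain_ends CC.
have [y yC cyq] := chain_pred CC qC neq_qp.
have /andP[py yq] := chain_bounds CC yC; have lt_yq := covers_lt cyq.
have CC' := chain_interval CC pC yC py.
set C' := [set u in C | _]%SET in CC'.
have defC : C = (q |: C')%SET.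
  apply/setP=> u; rewrite !inE; apply/idP/orP=> [uC|[/eqP->//|/andP[]//]].
  have /andP[pu uq] := chain_bounds CC uC.
  rewrite uC pu; have [->|neq_uq] := eqVneq u q; first by left.
  right; case/orP: (chain_comparable CC uC yC) => // yu.
  have [->|neq_uy] := eqVneq u y; first by rewrite lexx.
  by case/coversP: cyq => _ /(_ u); rewrite !lt_neqAle eq_sym neq_uy yu neq_uq uq => /(_ isT isT).
have qC' : q \notin C' by rewrite !inE (lt_geF lt_yq) !andbF.
rewrite defC; apply: (PS y) => //; apply: IHn => //.
by move: ltCn; rewrite defC cardsU1 qC'.
Qed.

Lemma chain_ind_dn q (P : S -> {set S} -> Prop) :
    P q [set q]%SET ->
    (forall y z C, C \in chains_between z q -> covers y z -> P z C ->
       P y (y |: C)%SET) ->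
  forall p C, C \in chains_between p q -> P p C.
Proof.
move=> P0 PS p C; have [n] := ubnP #|C|; elim: n p C => // n IHn p C ltCn CC.
have [eq_pq|neq_pq] := eqVneq p q.
  by move: CC; rewrite eq_pq chains_between_refl inE => /eqP->.
have /andP[pC qC] := chain_ends CC.
have [z zC cpz] := chain_succ CC pC neq_pq.
have /andP[pz zq] := chain_bounds CC zC; have lt_pz := covers_lt cpz.
have CC' := chain_interval CC zC qC zq.
set C' := [set u in C | _]%SET in CC'.
have defC : C = (p |: C')%SET.
  apply/setP=> u; rewrite !inE; apply/idP/orP=> [uC|[/eqP->//|/andP[]//]].
  have /andP[pu uq] := chain_bounds CC uC.
  rewrite uC uq andbT; have [->|neq_up] := eqVneq u p; first by left.
  right; case/orP: (chain_comparable CC zC uC) => // uz.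
  have [->|neq_uz] := eqVneq u z; first by rewrite lexx.
  by case/coversP: cpz => _ /(_ u); rewrite !lt_neqAle eq_sym neq_up pu neq_uz uz => /(_ isT isT).
have pC' : p \notin C' by rewrite !inE (lt_geF lt_pz) !andbF.
rewrite defC; apply: (PS _ z) => //; apply: IHn => //.
by move: ltCn; rewrite defC cardsU1 pC'.
Qed.

Lemma chain_cons_top p y z C :
  C \in chains_between p y -> covers y z -> (z |: C)%SET \in chains_between p z.
Proof.
move=> CC cyz; rewrite setUC.
have -> : (C :|: [set z] = C :|: [set y; z])%SET.
  apply/setP=> u; rewrite !inE; case: (eqVneq u y) => [->|//].
  by case/andP: (chain_ends CC) => _ ->.
by apply: chain_join CC _; rewrite chains_between_cover // inE.
Qed.

(** Connects [toggle], which sums over maximal chains, with [chains_between]: an element comparable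
    to all of a maximal chain belongs to it, which forces both the end points and saturation. *)
Lemma maximal_chainP b t C :
    (forall z, b <= z <= t) ->
  maxset (@is_chain d S) C = (C \in chains_between b t).
Proof.
move=> bt; apply/maxsetP/chains_betweenP=> [[/is_chainP chC maxC]|[/saturatedP[chC satC] bC tC _]].
  have addC u : {in C, forall v, u >=< v} -> u \in C.
    move=> uP; rewrite -(maxC (u |: C)%SET) ?setU11 ?subsetUr //.
    apply/is_chainP=> v w; rewrite !inE => /orP[/eqP->|vC] /orP[/eqP->|wC].
    - exact: comparablexx.
    - exact: uP.
    - by rewrite comparable_sym uP.
    - exact: chC.
  split=> //; last first.
  - by apply: addC => v _; rewrite ge_comparable //; case/andP: (bt v).
  - by apply: addC => v _; rewrite le_comparable //; case/andP: (bt v).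
  apply/saturatedP; split=> // u v uC vC uv Huv; apply/coversP; split=> // z uz zv.
  suff zC : z \in C by move: (Huv z zC); rewrite uz zv.
  apply: addC => w wC; case/orP: (chC _ _ wC uC) => [wu|uw].
    by rewrite ge_comparable // (le_trans wu (ltW uz)).
  case/orP: (chC _ _ wC vC) => [wv|vw]; last first.
    by rewrite le_comparable // (le_trans (ltW zv) vw).
  have [->|neq_wu] := eqVneq w u; first by rewrite ge_comparable // ltW.
  have [->|neq_wv] := eqVneq w v; first by rewrite le_comparable // ltW.
  by move: (Huv w wC); rewrite !lt_neqAle eq_sym neq_wu uw neq_wv wv.
have CC : C \in chains_between b t.
  by apply/chains_betweenP; split=> //; apply/saturatedP.
split=> [|B /is_chainP chB sCB]; first exact/is_chainP.
apply/eqP; rewrite eqEsubset sCB andbT; apply/subsetP=> z zB.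
(* Climbing [C] cover by cover, an element of the larger chain [B] weakly below the current top
   already lies in the part climbed. At [t] this catches all of [B]. *)
pose P y (C' : {set S}) := (C' \subset B)%SET -> z <= y -> z \in C'.
have PC : P t C.
  apply: (chain_ind_up _ _ CC) => [_ zb|y w C' CC' cyw IH]; rewrite /P.
    by rewrite inE eq_le zb; case/andP: (bt z).
  rewrite subUset sub1set => /andP[wB sC'B] zw; rewrite !inE.
  have [//|neq_zw /=] := eqVneq z w.
  case/andP: (chain_ends CC') => _ yC'.
  have yB : y \in B by move/subsetP: sC'B; apply.
  case/orP: (chB _ _ zB yB) => [|yz]; first exact: IH.
  have [->//|neq_zy] := eqVneq z y.
  by case/coversP: cyw => _ /(_ z); rewrite !lt_neqAle eq_sym neq_zy yz neq_zw zw => /(_ isT isT).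
by apply: PC => //; case/andP: (bt z).
Qed.

End Chains.

(** * Chain weights and rowmotion *)

Section Weights.
Context d (S : finPOrderType d) (R : realType).
Implicit Types (p q y z : S) (C : {set S}) (x : {ffun S -> R}).

Lemma prod_chain_join x p y q C1 C2 :
    C1 \in chains_between p y -> C2 \in chains_between y q ->
  (\prod_(u in C1) x u * \prod_(u in C2) x u =
   x y * \prod_(u in C1 :|: C2) x u)%R.
Proof.
move=> CC1 CC2.
have [/andP[_ yC1] /andP[yC2 _]] := (chain_ends CC1, chain_ends CC2).
rewrite [in RHS](big_setID C1) /= setUK setDUl setDv set0U (big_setD1 y yC2) /= mulrCA.
congr (_ * (_ * _))%R; apply: eq_bigl => u; rewrite !inE.
have [->|neq_uy] := eqVneq u y; first by rewrite yC1.
have [uC1|//] := boolP (u \in C1); apply/negbTE/negP => uC2.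
have [/andP[_ uy] /andP[yu _]] := (chain_bounds CC1 uC1, chain_bounds CC2 uC2).
by rewrite eq_le uy yu in neq_uy.
Qed.

Lemma chain_join_low p y q C1 C2 :
    C1 \in chains_between p y -> C2 \in chains_between y q ->
  [set u in C1 :|: C2 | p <= u <= y]%SET = C1.
Proof.
move=> CC1 CC2; have /andP[_ yC1] := chain_ends CC1.
apply/setP=> u; rewrite !inE; apply/andP/idP=> [[/orP[//|uC2] /andP[_ uy]]|uC1].
  by have /andP[yu _] := chain_bounds CC2 uC2; rewrite (@le_anti _ _ u y) ?uy.
by rewrite uC1 (chain_bounds CC1 uC1).
Qed.

Lemma chain_join_high p y q C1 C2 :
    C1 \in chains_between p y -> C2 \in chains_between y q ->
  [set u in C1 :|: C2 | y <= u <= q]%SET = C2.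
Proof.
move=> CC1 CC2; have /andP[yC2 _] := chain_ends CC2.
apply/setP=> u; rewrite !inE; apply/andP/idP=> [[/orP[uC1|//] /andP[yu _]]|uC2].
  by have /andP[_ uy] := chain_bounds CC1 uC1; rewrite (@le_anti _ _ u y) ?uy.
by rewrite uC2 orbT (chain_bounds CC2 uC2).
Qed.

Lemma chain_splitE p y q C :
    C \in chains_between p q -> y \in C ->
  ([set u in C | p <= u <= y] :|: [set u in C | y <= u <= q])%SET = C.
Proof.
move=> CC yC; apply/setP=> u; rewrite !inE -andb_orr andb_idr // => uC.
have /andP[-> ->] := chain_bounds CC uC; rewrite andbT.
exact: (chain_comparable CC uC yC).
Qed.

(** Chains through [y] correspond to pairs of halves cut at [y]; the factor [x y] appears because
    [y] lies in both halves. *)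
Lemma chain_weight_split x p y q :
  (x y * chain_weight [set C in chains_between p q | y \in C]%SET x =
   chain_weight (chains_between p y) x * chain_weight (chains_between y q) x)%R.
Proof.
rewrite /chain_weight big_distrlr /= pair_big /= big_distrr /=.
pose join (D : {set S} * {set S}) := (D.1 :|: D.2)%SET.
pose split C := ([set u in C | p <= u <= y]%SET, [set u in C | y <= u <= q]%SET).
rewrite (reindex_onto join split) /=; last first.
  by move=> C; rewrite inE => /andP[CC yC]; apply: chain_splitE.
apply: eq_big => [[C1 C2]|[C1 C2]] /=; last first.
  move: (join _) => C; rewrite inE => /andP[/andP[CC yC] /eqP[<- <-]].
  have /andP[pC qC] := chain_ends CC; have /andP[py yq] := chain_bounds CC yC.
  rewrite (prod_chain_join _ (chain_interval CC pC yC py) (chain_interval CC yC qC yq)).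
  by rewrite chain_splitE.
apply/andP/andP=> [|[CC1 CC2]].
  move: (join _) => C; rewrite inE => -[/andP[CC yC] /eqP[<- <-]].
  have /andP[pC qC] := chain_ends CC; have /andP[py yq] := chain_bounds CC yC.
  by rewrite !(chain_interval CC).
rewrite inE /join /split /= (chain_join CC1 CC2) !inE.
by rewrite (chain_join_low CC1 CC2) (chain_join_high CC1 CC2) eqxx; case/andP: (chain_ends CC1) => _ ->.
Qed.

Lemma chain_weight_cover x p q :
  covers p q -> chain_weight (chains_between p q) x = (x p * x q)%R.
Proof.
move=> cpq; rewrite /chain_weight chains_between_cover // big_set1.
by rewrite big_setU1 ?big_set1 // inE; apply: contraTneq (covers_lt cpq) => ->; rewrite ltxx.
Qed.

(** Chains are sorted by the element just below [q], which is unique because two elements of a chain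
    covered by [q] are comparable. Nonzero labels allow the factor from [chain_weight_split] to be
    cancelled. *)
Lemma chain_weight_recr x p q :
    (forall u, x u != 0%R) -> p != q ->
  (chain_weight (chains_between p q) x =
   x q * \sum_(y | covers y q) chain_weight (chains_between p y) x)%R.
Proof.
move=> x0 neq_pq; transitivity
  (\sum_(y | covers y q) chain_weight [set C in chains_between p q | y \in C]%SET x)%R; last first.
  rewrite big_distrr /=; apply: eq_bigr => y cyq.
  apply: (mulfI (x0 y)); rewrite chain_weight_split (chain_weight_cover _ cyq).
  by rewrite mulrC -mulrA.
rewrite /chain_weight; under [RHS]eq_bigr do under eq_bigl do rewrite inE.
rewrite [RHS](exchange_big_dep (mem (chains_between p q))) /=; last by move=> y C _ /andP[].
apply: eq_bigr => C CC; have /andP[pC qC] := chain_ends CC.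
have [y yC cyq] := chain_pred CC qC (contra_neq esym neq_pq).
rewrite [RHS](big_pred1 y) // => z /=; rewrite CC /=; apply/andP/eqP=> [[czq zC]|->//].
have [lt_yq lt_zq] := (covers_lt cyq, covers_lt czq).
case/orP: (chain_comparable CC zC yC); rewrite le_eqVlt => /orP[/eqP//|zy].
  by case/coversP: czq => _ /(_ y zy lt_yq).
by case/coversP: cyq => _ /(_ z zy lt_zq).
Qed.

Lemma chain_weight_recl x p q :
    (forall u, x u != 0%R) -> p != q ->
  (chain_weight (chains_between p q) x =
   x p * \sum_(y | covers p y) chain_weight (chains_between y q) x)%R.
Proof.
move=> x0 neq_pq; transitivity
  (\sum_(y | covers p y) chain_weight [set C in chains_between p q | y \in C]%SET x)%R; last first.
  rewrite big_distrr /=; apply: eq_bigr => y cpy.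
  apply: (mulfI (x0 y)); rewrite chain_weight_split (chain_weight_cover _ cpy).
  by rewrite -mulrA mulrCA.
rewrite /chain_weight; under [RHS]eq_bigr do under eq_bigl do rewrite inE.
rewrite [RHS](exchange_big_dep (mem (chains_between p q))) /=; last by move=> y C _ /andP[].
apply: eq_bigr => C CC; have /andP[pC qC] := chain_ends CC.
have [y yC cpy] := chain_succ CC pC neq_pq.
rewrite [RHS](big_pred1 y) // => z /=; rewrite CC /=; apply/andP/eqP=> [[cpz zC]|->//].
have [lt_py lt_pz] := (covers_lt cpy, covers_lt cpz).
case/orP: (chain_comparable CC zC yC); rewrite le_eqVlt => /orP[/eqP//|zy].
  by case/coversP: cpy => _ /(_ z lt_pz zy).
by case/coversP: cpz => _ /(_ y lt_py zy).
Qed.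

Lemma chain_weight_ge0 CC x :
  (forall u, (0 < x u)%R) -> (0 <= chain_weight CC x)%R.
Proof. by move=> x0; apply: sumr_ge0 => C _; apply: prodr_ge0 => u _; apply: ltW. Qed.

Lemma eq_chain_weight x1 x2 p q :
    (forall u, p <= u <= q -> x1 u = x2 u) ->
  chain_weight (chains_between p q) x1 = chain_weight (chains_between p q) x2.
Proof.
move=> eqx; apply: eq_bigr => C CC; apply: eq_bigr => u uC.
exact: eqx (chain_bounds CC uC).
Qed.

(** Only the factor at the top differs between the two weights. This compares the weights before and
    after the toggle at [q]. *)
Lemma chain_weight_top_scale x1 x2 p q :
    (forall u, u < q -> x1 u = x2 u) ->
  (x2 q * chain_weight (chains_between p q) x1 =
   x1 q * chain_weight (chains_between p q) x2)%R.
Proof.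
move=> eqx; rewrite !big_distrr /=; apply: eq_bigr => C CC.
have /andP[_ qC] := chain_ends CC.
rewrite !(big_setD1 q qC) /= mulrCA; congr (_ * (_ * _))%R.
apply: eq_bigr => u; rewrite !inE => /andP[neq_uq /(chain_bounds CC)/andP[_ uq]].
by apply: eqx; rewrite lt_neqAle neq_uq.
Qed.

End Weights.

Section Rowmotion.
Context d (S : finPOrderType d) (R : realType).
Variables (lam : S -> 'I_#|S|) (laminv : 'I_#|S| -> S).
Hypothesis lamP : linear_extension lam laminv.
Implicit Types (x z : {ffun S -> R}).

Lemma toggle_fold_notin (ks : seq 'I_#|S|) x q :
  lam q \notin ks -> foldl (fun y k => toggle (laminv k) y) x ks q = x q.
Proof.
case: lamP => lamK laminvK _; elim: ks x => //= k ks IH x.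
rewrite inE negb_or => /andP[neq_k qks]; rewrite IH // ffunE.
by case: eqP => // eq_q; rewrite eq_q laminvK eqxx in neq_k.
Qed.

(* The toggle at [p] sees the already updated values strictly below [p] and the
   old ones weakly above it, so it enforces exactly this relation at [p], and
   later toggles preserve it. *)
Lemma rowmotion_chain_weights (b t : S) x z :
    (forall p, b <= p <= t) -> positive_labeling z -> positive_labeling x ->
    rowmotion laminv z = x ->
  forall p, (chain_weight (chains_between b p) x *
             chain_weight (chains_between p t) z = 1)%R.
Proof.
case: lamP => lamK laminvK lam_mono bt z0 x0 def_x p.
have kE : lam p \in enum 'I_#|S| by rewrite mem_enum.
have : pairwise (fun i j : 'I_#|S| => (i < j)%N) (enum 'I_#|S|).
  rewrite -(pairwise_map (fun i : 'I_#|S| => i : nat) ltn) val_enum_ord.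
  rewrite -sorted_pairwise ?iota_ltn_sorted //.
  exact: ltn_trans.
move: def_x; rewrite /rowmotion; case/splitPr: kE => s1 s2.
rewrite pairwise_cat pairwise_cons foldl_cat /=.
(* [y] is the labeling just before the toggle at [p]: it agrees with [z] weakly above [p] and with
   [x] strictly below. *)
rewrite lamK; set y := foldl _ z s1 => def_x /and3P[/allrelP s1P _ /andP[/allP /= s2P _]].
have ps2 q : q <= p -> lam q \notin s2.
  by move=> /lam_mono; apply: contraL => /s2P; rewrite ltnNge.
have yz q : p <= q -> y q = z q.
  move=> /lam_mono qp; apply: toggle_fold_notin; apply: contraL qp => /s1P H.
  by rewrite -ltnNge; apply: H; rewrite inE eqxx.
have xy q : q < p -> x q = y q.
  move=> qp; rewrite -def_x toggle_fold_notin ?ps2 ?(ltW qp) // ffunE.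
  by case: eqP qp => // ->; rewrite ltxx.
have xp : x p = ((chain_weight [set C in chains_between b t | p \in C] y)^-1)%R.
  rewrite -def_x toggle_fold_notin ?ps2 // ffunE eqxx; congr (chain_weight _ _)^-1%R.
  by apply/setP=> C; rewrite !inE (maximal_chainP _ bt) inE.
have y0 : y p != 0%R by rewrite yz // gt_eqF.
have Wx : (y p * chain_weight (chains_between b p) x = x p * chain_weight (chains_between b p) y)%R.
  exact: chain_weight_top_scale.
have Wz : chain_weight (chains_between p t) z = chain_weight (chains_between p t) y.
  by apply: eq_chain_weight => u /andP[pu _]; rewrite yz.
apply: (mulfI y0); rewrite Wz mulrA Wx -mulrA -chain_weight_split mulrCA xp.
(* Since the inverse of 0 is 0, a zero weight of the chains through [p] would give [x p = 0],
   against positivity. *)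
rewrite mulVf //; apply: contraTneq (x0 p) => W0.
by rewrite xp W0 invr0 ltxx.
Qed.

End Rowmotion.

(** * Chains as directed walks *)

Section ConnectSteps.
Variables (T : finType) (e : rel T).

Lemma connect_step_left p q :
  connect e p q -> p != q -> exists2 u, e p u & connect e u q.
Proof.
case/connectP=> [[|u s]] /= => [_ ->|/andP[epu us] ->]; first by rewrite eqxx.
by exists u => //; apply/connectP; exists s.
Qed.

Lemma connect_step_right p q :
  connect e p q -> p != q -> exists2 u, connect e p u & e u q.
Proof.
case/connectP=> s; case/lastP: s => [|s u] /= => [_ ->|]; first by rewrite eqxx.
rewrite rcons_path last_rcons => /andP[ps eu] -> _.
by exists (last p s) => //; apply/connectP; exists s.
Qed.

End ConnectSteps.

Section ChainPaths.
Context d (S : finPOrderType d) (e : rel S).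
Hypothesis e_covers : forall p q, e p q -> covers p q.
Implicit Types (p q y z : S) (C : {set S}).

Definition steps_in C := [forall y in C, forall z in C, covers y z ==> e y z].

Lemma steps_inP C :
  reflect {in C &, forall y z, covers y z -> e y z} (steps_in C).
Proof.
apply: (iffP forall_inP) => [H y z yC zC|H y yC].
  by move/forall_inP/(_ z zC)/implyP: (H y yC).
by apply/forall_inP=> z zC; apply/implyP; apply: H.
Qed.

Lemma connect_le p q : connect e p q -> p <= q.
Proof.
case/connectP=> s; elim: s p => [|u s IH] p /= => [_ ->//|/andP[/e_covers/covers_lt pu us] eq_q].
by apply: le_trans (ltW pu) _; apply: IH.
Qed.

Lemma chain_connect p q C :
  C \in chains_between p q -> steps_in C -> connect e p q.
Proof.
move: q C; apply: chain_ind_up => [_|y z C CC cyz IH /steps_inP eC]; first exact: connect0.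
have /andP[_ yC] := chain_ends CC.
apply: (connect_trans (IH _)).
  by apply/steps_inP=> u v uC vC; apply: eC; rewrite inE ?uC ?vC orbT.
by apply: connect1; apply: eC; rewrite // !inE ?eqxx ?yC ?orbT.
Qed.

Lemma connect_chain p q :
  connect e p q -> exists2 C, C \in chains_between p q & steps_in C.
Proof.
case/connectP=> s; elim/last_ind: s q => [|s z IH] q /=.
  move=> _ ->; exists [set p]%SET; first by rewrite chains_between_refl inE.
  by apply/steps_inP=> u v; rewrite !inE => /eqP-> /eqP-> /covers_lt; rewrite ltxx.
rewrite rcons_path last_rcons => /andP[/IH/(_ erefl) [C CC /steps_inP eC] elz] ->.
have clz := e_covers elz; exists (z |: C)%SET; first exact: chain_cons_top clz.
have Clz u : u \in C -> u < z.
  by move=> /(chain_bounds CC)/andP[_ ul]; apply: le_lt_trans ul (covers_lt clz).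
apply/steps_inP=> u v; rewrite !inE => /orP[/eqP->|uC] /orP[/eqP->|vC] cuv.
- by move: (covers_lt cuv); rewrite ltxx.
- by move: (covers_lt cuv); rewrite (lt_gtF (Clz v vC)).
- have [->//|neq_ul] := eqVneq u (last p s).
  have /andP[_ ul] := chain_bounds CC uC.
  by case/coversP: cuv => _ /(_ (last p s)); rewrite lt_neqAle neq_ul ul (covers_lt clz) => /(_ isT isT).
- exact: eC.
Qed.

(** Turns a chain that meets the left border into two reachability statements, the only form in
    which chains enter the planar argument. *)
Lemma connect_chain_through p z q :
  (exists C, [/\ C \in chains_between p q, z \in C & steps_in C]) <->
  (connect e p z /\ connect e z q).
Proof.
split=> [[C [CC zC /steps_inP eC]]|[/connect_chain[C1 CC1 /steps_inP e1]]].
  have [/andP[pC qC] /andP[pz zq]] := (chain_ends CC, chain_bounds CC zC).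
  split; [move: (chain_interval CC pC zC pz)|move: (chain_interval CC zC qC zq)].
    move/chain_connect; apply; apply/steps_inP=> u v; rewrite !inE => /andP[uC _] /andP[vC _].
    exact: eC.
  move/chain_connect; apply; apply/steps_inP=> u v; rewrite !inE => /andP[uC _] /andP[vC _].
  exact: eC.
case/connect_chain=> C2 CC2 /steps_inP e2.
exists (C1 :|: C2)%SET; split; first exact: chain_join CC1 CC2.
  by rewrite inE; case/andP: (chain_ends CC1) => _ ->.
have [/andP[_ zC1] /andP[zC2 _]] := (chain_ends CC1, chain_ends CC2).
apply/steps_inP=> u v; rewrite !inE => /orP[] uC /orP[] vC cuv.
- exact: e1.
(* A cover from the lower chain to the upper one cannot jump over [z], so one of its ends is [z] and
   it lies inside one of the two chains. *)
- have [/andP[_ uz] /andP[zv _]] := (chain_bounds CC1 uC, chain_bounds CC2 vC).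
  have [eq_uz|neq_uz] := eqVneq u z; first by apply: e2 => //; rewrite eq_uz.
  have [eq_vz|neq_vz] := eqVneq v z; first by apply: e1 => //; rewrite eq_vz.
  by case/coversP: cuv => _ /(_ z); rewrite !lt_neqAle neq_uz uz eq_sym neq_vz zv => /(_ isT isT).
- have [/andP[zu _] /andP[_ vz]] := (chain_bounds CC2 uC, chain_bounds CC1 vC).
  by move: (covers_lt cuv); rewrite (le_gtF (le_trans vz zu)).
- exact: e2.
Qed.

(** With at most one step down from each element, the descent from [q] is deterministic, so as long
    as it stays above [p] it runs inside [C]. *)
Lemma chain_down_unique p q C z :
    (forall u v y, e u y -> e v y -> u = v) ->
    C \in chains_between p q -> steps_in C -> p <= z -> connect e z q -> z \in C.
Proof.
move=> e_fun CC /steps_inP eC pz; case/connectP=> s.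
have /andP[_ qC] := chain_ends CC.
elim: s z pz => [|u s IH] z pz /= => [_ <-//|/andP[ezu us] eq_q].
have czu := e_covers ezu; have lt_zu := covers_lt czu.
have pu : p < u := le_lt_trans pz lt_zu.
have uC : u \in C by apply: IH => //; apply: ltW.
have [y yC cyu] := chain_pred CC uC (negbT (gt_eqF pu)).
by rewrite (e_fun _ _ _ ezu (eC _ _ yC uC cyu)).
Qed.

Lemma chain_up_unique p q C z :
    (forall u v y, e y u -> e y v -> u = v) ->
    C \in chains_between p q -> steps_in C -> z <= q -> connect e p z -> z \in C.
Proof.
move=> e_fun CC /steps_inP eC + /connectP[s].
have /andP[pC _] := chain_ends CC.
elim/last_ind: s z => [|s u IH] z /= => [_ _ ->//|uq].
rewrite rcons_path last_rcons => /andP[ps elu] eq_z; rewrite {}eq_z in uq *.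
have clu := e_covers elu; have lq := lt_le_trans (covers_lt clu) uq.
have lC : last p s \in C by apply: IH => //; apply: ltW.
have [y yC cly] := chain_succ CC lC (negbT (lt_eqF lq)).
by rewrite (e_fun _ _ _ elu (eC _ _ lC yC cly)).
Qed.

End ChainPaths.

(** * Coordinates on the trapezoid *)

Section Coordinates.
Variables r s : nat.
Implicit Types p q : RT r s.

Lemma RT_leE p q : (p <= q) = (ci p <= ci q)%N && (cj p <= cj q)%N.
Proof. by []. Qed.

Lemma RT_inj p q : ci p = ci q -> cj p = cj q -> p = q.
Proof.
case: p q => [[i j] p_in] [[i' j'] q_in]; rewrite /ci /cj /= => -[eq_i] [eq_j].
by apply: val_inj; congr (_, _); apply: val_inj.
Qed.

Lemma RT_bounds p :
  [/\ (0 < ci p)%N, (0 < cj p)%N, (cj p <= s)%N & (ci p < cj p + r)%N].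
Proof. by case: p => [[i j] p_in]; rewrite /ci /cj; split=> //=; apply: ltn_ord. Qed.

Lemma RT_at i j : (0 < i)%N -> (0 < j <= s)%N -> (i < j + r)%N ->
  exists p : RT r s, ci p = i /\ cj p = j.
Proof.
case: i j => // i [//|j] _ /= lt_js lt_ij.
have lt_i : (i < r + s - 1)%N by lia.
have p_in : in_RT (Ordinal lt_i, Ordinal lt_js) by rewrite /in_RT /=; lia.
by exists (MkRT p_in).
Qed.

Lemma RT_coversP p q :
  reflect ((ci q = (ci p).+1 /\ cj q = cj p) \/ (ci q = ci p /\ cj q = (cj p).+1))
          (covers p q).
Proof.
apply: (iffP (coversP p q)) => [[lt_pq H]|H].
  have : ~~ (q <= p) by rewrite lt_geF.
  have := ltW lt_pq; rewrite !RT_leE => /andP[le_i le_j] not_le.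
  have [p1 p2 p3 p4] := RT_bounds p; have [q1 q2 q3 q4] := RT_bounds q.
  have [eq_j|neq_j] := eqVneq (cj q) (cj p).
    left; split=> //; have [z [zi zj]] : exists z : RT r s, ci z = (ci p).+1 /\ cj z = cj p.
      by apply: RT_at; lia.
    have [|] := eqVneq q z; first by move->.
    move=> neq_qz; case: (H z); rewrite lt_neqAle RT_leE; apply/andP; split; try lia.
      by apply/eqP=> /(congr1 (@ci r s)); lia.
    by rewrite eq_sym.
  right.
  have [z [zi zj]] : exists z : RT r s, ci z = ci p /\ cj z = (cj p).+1.
    by apply: RT_at; lia.
  have [->//|neq_qz] := eqVneq q z.
  case: (H z); rewrite lt_neqAle RT_leE; apply/andP; split; try lia.
    by apply/eqP=> /(congr1 (@cj r s)); lia.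
  by rewrite eq_sym.
split.
  rewrite lt_neqAle RT_leE; apply/andP; split; last by lia.
  by apply/eqP=> eq_pq; rewrite eq_pq in H; lia.
move=> z; rewrite !lt_neqAle !RT_leE => /andP[/eqP neq_pz le_pz] /andP[/eqP neq_zq le_zq].
have : ~ (ci p = ci z /\ cj p = cj z) by case=> ? ?; apply/neq_pz/RT_inj.
have : ~ (ci z = ci q /\ cj z = cj q) by case=> ? ?; apply/neq_zq/RT_inj.
lia.
Qed.

(** This is i - j = r - 1, the extreme value in the trapezoid, written without truncated
    subtraction. *)
Definition on_left p := (ci p + 1 == cj p + r)%N.

Lemma left_borderE p : (p \in left_border r s) = on_left p.
Proof.
have [p1 p2 p3 p4] := RT_bounds p; rewrite inE /on_left.
apply/existsP/idP=> [[l /and3P[l0 /eqP pi /eqP pj]]|/eqP pL]; first by lia.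
have lt_j : (cj p < s.+1)%N by [].
by exists (Ordinal lt_j) => /=; lia.
Qed.

(** If i > 1, then (i-1, j) is still in the trapezoid, and it belongs to [se p] with k = 0. *)
Lemma se_empty p : se p = classical_sets.set0 -> ci p = 1%N.
Proof.
move=> se_p; have [p1 p2 p3 p4] := RT_bounds p.
have [//|neq_i1] := eqVneq (ci p) 1%N; exfalso.
have [q [qi qj]] : exists q : RT r s, ci q = (ci p).-1 /\ cj q = cj p.
  by apply: RT_at; lia.
have : (classical_sets.set0 : set (RT r s)) q by rewrite -se_p; exists 0%R; split; lia.
by [].
Qed.

(** If j < s, then (i, j+1) is still in the trapezoid, and it belongs to [ne p] with k = -1. *)
Lemma ne_empty p : ne p = classical_sets.set0 -> cj p = s.
Proof.
move=> ne_p; have [p1 p2 p3 p4] := RT_bounds p.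
have [//|neq_js] := eqVneq (cj p) s; exfalso.
have [q [qi qj]] : exists q : RT r s, ci q = ci p /\ cj q = (cj p).+1.
  by apply: RT_at; lia.
have : (classical_sets.set0 : set (RT r s)) q by rewrite -ne_p; exists (-1)%R; split; lia.
by [].
Qed.

End Coordinates.

(** * Non-crossing walks *)

Section NonCrossing.
Variables (r s : nat) (dn up : rel (RT r s)).
Implicit Types p q u v X : RT r s.
Hypothesis dn_covers : forall p q, dn p q -> covers p q.
Hypothesis up_covers : forall p q, up p q -> covers p q.
Hypothesis dn_exists : forall q, ~ (ci q = 1%N /\ cj q = 1%N) -> exists p, dn p q.
Hypothesis up_exists : forall p, ~ (cj p = s /\ on_left p) -> exists q, up p q.
(** In a unit square with bottom [p] and top [v], the step up from [p] and the step down from [v] go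
    to different corners. When [p] is on the left border there is only one corner between [p] and
    [v], and both steps may use it. *)
Hypothesis noncrossing : forall p q v, up p q -> dn q v ->
  ci v = (ci p).+1 -> cj v = (cj p).+1 -> on_left p.

Let dn_step p q : dn p q ->
  (ci q = (ci p).+1 /\ cj q = cj p) \/ (ci q = ci p /\ cj q = (cj p).+1).
Proof. by move/dn_covers/RT_coversP. Qed.

Let up_step p q : up p q ->
  (ci q = (ci p).+1 /\ cj q = cj p) \/ (ci q = ci p /\ cj q = (cj p).+1).
Proof. by move/up_covers/RT_coversP. Qed.

Let dn_le p q : connect dn p q -> (ci p <= ci q)%N /\ (cj p <= cj q)%N.
Proof. by move/(connect_le dn_covers); rewrite RT_leE => /andP. Qed.

Let up_le p q : connect up p q -> (ci p <= ci q)%N /\ (cj p <= cj q)%N.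
Proof. by move/(connect_le up_covers); rewrite RT_leE => /andP. Qed.

(* The conditions on [p] and [q] say that [q] is on the lower right of the walk
   from [X] down (first coordinate to the right, second one upwards); a step up
   from [q] cannot leave this side.  The next three lemmas use the same kind of
   invariant. *)
Lemma up_reaches_left X q p : on_left X ->
    connect dn p X -> (ci p <= ci q)%N -> (cj q < cj p)%N ->
  exists2 l, on_left l && (cj l < cj X)%N & connect up q l.
Proof.
move=> /eqP XL; have [X1 X2 X3 X4] := RT_bounds X.
have [n] := ubnP (r + s + s - ci q - cj q)%N; elim: n q p => // n IHn q p lt_n.
move=> pX le_pq lt_qp; have [q1 q2 q3 q4] := RT_bounds q.
have [Xi Xj] := dn_le pX.
have [qL|/negP qL] := boolP (on_left q); first by exists q; rewrite ?qL ?connect0 //; lia.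
have [|q' qq'] := @up_exists q; first by case.
have [q'1 q'2 q'3 q'4] := RT_bounds q'.
suff [p' p'X [le_p' lt_p']] : exists2 p', connect dn p' X & (ci p' <= ci q')%N /\ (cj q' < cj p')%N.
  have [|l lL q'l] := IHn q' p' _ p'X le_p' lt_p'.
    by have := up_step qq'; lia.
  by exists l => //; apply: connect_trans (connect1 qq') q'l.
case: (up_step qq') => -[qi qj]; first by exists p => //; lia.
(* A step in direction j may bring [q] level with [p]; then [p] slides along the walk towards [X]
   until it is above again. It cannot get stuck at [X], which is extreme in its row, nor pass
   through [q'], which would be a crossing off the left border. *)
have [k] := ubnP (ci q - ci p)%N; elim: k p pX le_pq lt_qp Xi Xj => // k IHk p pX le_pq lt_qp Xi Xj lt_k.
have [lt_q'p|ge_q'p] := ltnP (cj q') (cj p); first by exists p => //; lia.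
have [eq_pX|neq_pX] := eqVneq p X.
  by subst p; lia.
have [p1 pp1 p1X] := connect_step_left pX neq_pX; have [p1i p1j] := dn_le p1X.
case: (dn_step pp1) => -[ei ej]; last by exists p1 => //; lia.
have [eq_i|neq_i] := eqVneq (ci p) (ci q); last by apply: (IHk p1) => //; lia.
have eq_p : p = q' by apply: RT_inj; lia.
by case: qL; subst p; apply: noncrossing qq' pp1 _ _; lia.
Qed.

Lemma up_reaches_top_row M M' X q : cj M = s -> cj M' = s -> ci M = (ci M').+1 ->
    on_left X -> connect dn X M ->
    ((cj q < cj X)%N \/ exists2 p, connect dn p M & (ci q < ci p)%N /\ (cj p <= cj q)%N) ->
  connect up q M'.
Proof.
move=> Mj M'j Mi /eqP XL XM.
have [n] := ubnP (r + s + s - ci q - cj q)%N; elim: n q => // n IHn q lt_n Hq.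
have [q1 q2 q3 q4] := RT_bounds q; have [X1 X2 X3 X4] := RT_bounds X.
have [M1 M2 M3 M4] := RT_bounds M.
have [Xi Xj] := dn_le XM.
(* Once on the top row the walk up has not yet passed [M'], the neighbour of [M]. *)
have lt_qM : cj q = s -> (ci q < ci M)%N.
  by case: Hq => [|[p /dn_le pM]]; lia.
have [eq_qM|neq_qM] := eqVneq q M'; first by rewrite eq_qM connect0.
have [|q' qq'] := @up_exists q.
  by case=> eq_j /eqP qL; have := lt_qM eq_j; lia.
have [q'1 q'2 q'3 q'4] := RT_bounds q'.
apply: connect_trans (connect1 qq') (IHn _ _ _).
  by have := up_step qq'; lia.
case: (up_step qq') => -[qi qj].
  have [js|js] := eqVneq (cj q) s.
    right; exists M; first exact: connect0.
    have : ci q <> ci M' by move=> eq_i; case/eqP: neq_qM; apply: RT_inj; lia.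
    by have := lt_qM js; lia.
  case: Hq => [|[p pM [lt_qp le_pq]]]; [left; lia|right].
  have [k] := ubnP (cj q - cj p)%N; elim: k p pM lt_qp le_pq => // k IHk p pM lt_qp le_pq lt_k.
  have [lt_q'p|ge_q'p] := ltnP (ci q') (ci p); first by exists p => //; lia.
  have [eq_pM|neq_pM] := eqVneq p M; first by subst p; lia.
  have [p1 pp1 p1M] := connect_step_left pM neq_pM.
  case: (dn_step pp1) => -[ei ej]; first by exists p1 => //; lia.
  have [eq_j|neq_j] := eqVneq (cj p) (cj q); last by apply: (IHk p1) => //; lia.
  have eq_p : p = q' by apply: RT_inj; lia.
  have /eqP : on_left q by subst p; apply: noncrossing qq' pp1 _ _; lia.
  lia.
case: Hq => [lt_qX|[p pM [lt_qp le_pq]]]; last by right; exists p => //; lia.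
(* On reaching the row of [X], the witness becomes [X] itself: a point one row lower has a smaller
   first coordinate because [X] is on the left border. *)
by have [?|?] := ltnP (cj q') (cj X); [left|right; exists X => //; lia].
Qed.

Lemma dn_reaches_left X p q : on_left X ->
    connect up X q -> (ci q < ci p)%N -> (cj p <= cj q)%N ->
  exists2 l, on_left l && (cj X < cj l)%N & connect dn l p.
Proof.
move=> /eqP XL; have [X1 X2 X3 X4] := RT_bounds X.
have [n] := ubnP (ci p + cj p)%N; elim: n p q => // n IHn p q lt_n Xq lt_qp le_pq.
have [p1 p2 p3 p4] := RT_bounds p; have [q1 q2 q3 q4] := RT_bounds q.
have [Xi Xj] := up_le Xq.
have [pL|/negP pL] := boolP (on_left p).
  by exists p; rewrite ?connect0 // pL; move/eqP: pL; lia.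
have [|p' p'p] := @dn_exists p; first by lia.
have [p'1 p'2 p'3 p'4] := RT_bounds p'.
suff [q' Xq' [lt_q' le_q']] : exists2 q', connect up X q' & (ci q' < ci p')%N /\ (cj p' <= cj q')%N.
  have [|l lL lp'] := IHn p' q' _ Xq' lt_q' le_q'.
    by have := dn_step p'p; lia.
  by exists l => //; apply: connect_trans lp' (connect1 p'p).
case: (dn_step p'p) => -[pi pj]; last by exists q => //; lia.
have [k] := ubnP (cj q - cj p)%N; elim: k q Xq lt_qp le_pq q1 q2 q3 q4 Xi Xj => // k IHk q Xq.
move=> lt_qp le_pq q1 q2 q3 q4 Xi Xj lt_k.
have [lt_qp'|ge_qp'] := ltnP (ci q) (ci p'); first by exists q => //; lia.
have [eq_qX|neq_qX] := eqVneq X q; first by subst q; lia.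
have [q0 Xq0 q0q] := connect_step_right Xq neq_qX.
have [q01 q02 q03 q04] := RT_bounds q0; have [q0i q0j] := up_le Xq0.
case: (up_step q0q) => -[ei ej]; first by exists q0 => //; lia.
have [eq_j|neq_j] := eqVneq (cj q) (cj p); last by apply: (IHk q0) => //; lia.
have eq_q : q = p' by apply: RT_inj; lia.
case: pL; subst q; have /eqP := noncrossing q0q p'p ltac:(lia) ltac:(lia).
by rewrite /on_left; lia.
Qed.

Lemma dn_reaches_bottom_row m m' X p : ci m = 1%N -> ci m' = 1%N -> cj m = (cj m').+1 ->
    on_left X -> connect up m' X ->
    ((ci X < ci p)%N \/ exists2 q, connect up m' q & (ci p <= ci q)%N /\ (cj q < cj p)%N) ->
  connect dn m p.
Proof.
move=> mi m'i mj /eqP XL m'X.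
have [n] := ubnP (ci p + cj p)%N; elim: n p => // n IHn p lt_n Hp.
have [p1 p2 p3 p4] := RT_bounds p; have [X1 X2 X3 X4] := RT_bounds X.
have [m1 m2 m3 m4] := RT_bounds m'.
have [Xi Xj] := up_le m'X.
have lt_mp : ci p = 1%N -> (cj m' < cj p)%N.
  by case: Hp => [|[q /up_le m'q]]; lia.
have [eq_mp|neq_mp] := eqVneq m p; first by rewrite eq_mp connect0.
have [|p' p'p] := @dn_exists p.
  by case=> eq_i pj; have := lt_mp eq_i; lia.
have [p'1 p'2 p'3 p'4] := RT_bounds p'.
apply: connect_trans (IHn _ _ _) (connect1 p'p).
  by have := dn_step p'p; lia.
case: (dn_step p'p) => -[pi pj].
  case: Hp => [lt_Xp|[q m'q [le_pq lt_qp]]]; last by right; exists q => //; lia.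
  by have [?|?] := ltnP (ci X) (ci p'); [left|right; exists X => //; lia].
have [i1|i1] := eqVneq (ci p) 1%N.
  right; exists m'; first exact: connect0.
  have : cj p <> cj m by move=> eq_j; case/eqP: neq_mp; apply: RT_inj; lia.
  by have := lt_mp i1; lia.
case: Hp => [|[q m'q [le_pq lt_qp]]]; [left; lia|right].
have [k] := ubnP (ci q - ci p)%N; elim: k q m'q le_pq lt_qp => // k IHk q m'q le_pq lt_qp lt_k.
have [lt_qp'|ge_qp'] := ltnP (cj q) (cj p'); first by exists q => //; lia.
have [eq_qm|neq_qm] := eqVneq m' q; first by subst q; lia.
have [q0 m'q0 q0q] := connect_step_right m'q neq_qm.
case: (up_step q0q) => -[ei ej]; last by exists q0 => //; lia.
have [eq_i|neq_i] := eqVneq (ci q) (ci p); last by apply: (IHk q0) => //; lia.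
have eq_q : q = p' by apply: RT_inj; lia.
subst q; have /eqP := noncrossing q0q p'p ltac:(lia) ltac:(lia).
lia.
Qed.

(** [m'] lies just beneath the lower end of the walk down. The walk up from [m'] is enclosed by the
    left border and the part of the walk down from [l] to [m], so it hits the border below [l]; from
    there it stays upper left of the part from [M] to [l], which leads it to [M']. Conversely, the
    walk down hits the border above the given point. *)
Lemma through_left_duality m' m M' M :
    ci m = 1%N -> ci m' = 1%N -> cj m = (cj m').+1 ->
    cj M = s -> cj M' = s -> ci M = (ci M').+1 ->
  (exists l, [/\ on_left l, connect dn m l & connect dn l M]) <->
  (exists l, [/\ on_left l, connect up m' l & connect up l M']).
Proof.
move=> mi m'i mj Mj M'j Mi; split=> -[l [lL ml lM]].
  have [||l' /andP[l'L lt_l'l] m'l'] := @up_reaches_left l m' m lL ml; try lia.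
  exists l'; split=> //; apply: (@up_reaches_top_row M M' l) => //; by left.
have [||l' /andP[l'L lt_ll'] l'M] := @dn_reaches_left l M M' lL lM; try lia.
exists l'; split=> //; apply: (@dn_reaches_bottom_row m m' l) => //; left.
by move/eqP: lL; move/eqP: l'L; lia.
Qed.

End NonCrossing.

(** * Arborescences *)

Section HatCovers.
Context d (S : finPOrderType d).
Implicit Types (p q : S) (a b : hat S) (T : {set edge S}).

Lemma inhat_inj : injective (@inhat S).
Proof. by move=> p q []. Qed.

Lemma inhat_lt p q : (inhat p < inhat q :> hat S) = (p < q).
Proof. by rewrite !lt_neqAle. Qed.

Lemma hat_le_top a : a <= (htop : hat S).
Proof. by case: a => [[p|]|]. Qed.

Lemma hat_ge_bot a : (hbot : hat S) <= a.
Proof. by case: a => [[p|]|]. Qed.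

Lemma hat_covers p q : covers (inhat p) (inhat q) = covers p q.
Proof.
rewrite /covers inhat_lt; congr (_ && _); apply/forallP/forallP=> H z.
  by have := H (inhat z); rewrite !inhat_lt.
case: z => [[z|]|].
- by have := H z; rewrite -!inhat_lt.
- by rewrite (le_gtF (hat_le_top (inhat q))) andbF.
- by rewrite (le_gtF (hat_ge_bot (inhat p))).
Qed.

Lemma hat_covers_top p : covers (inhat p) htop <-> forall q, ~ p < q.
Proof.
split=> [/coversP[_ H] q pq|H]; first by apply: (H (inhat q)); rewrite ?inhat_lt.
apply/coversP; split=> // -[[z|]|] //.
by rewrite inhat_lt => /H.
Qed.

Lemma hat_covers_bot p : covers hbot (inhat p) <-> forall q, ~ q < p.
Proof.
split=> [/coversP[_ H] q pq|H]; first by apply: (H (inhat q)); rewrite ?inhat_lt.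
apply/coversP; split=> // -[[z|]|] //.
by rewrite inhat_lt => _ /H.
Qed.

Lemma covers_htop a : covers htop a = false.
Proof. by apply/negbTE/negP=> /covers_lt; rewrite (le_gtF (hat_le_top a)). Qed.

Lemma covers_hbot a : covers a hbot = false.
Proof. by apply/negbTE/negP=> /covers_lt; rewrite (le_gtF (hat_ge_bot a)). Qed.

Lemma card_set_ex1 (E : finType) (A : {set E}) :
  reflect (exists2 e, e \in A & forall e', e' \in A -> e' = e) (#|A| == 1)%N.
Proof.
apply: (iffP cards1P) => [[e ->]|[e eA H]]; exists e; rewrite ?inE //.
  by move=> e' /set1P.
by apply/setP=> e'; rewrite inE; apply/idP/eqP=> [/H|->].
Qed.

Lemma up_arbP T :
  reflect ((forall a b, (a, b) \in T -> covers a b /\ b <> htop) /\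
           (forall p, exists2 a, (a, inhat p) \in T &
                        forall a', (a', inhat p) \in T -> a' = a))
          (T \in up_arborescences S).
Proof.
rewrite inE; apply: (iffP andP) => -[H1 H2]; split.
- by move=> a b /(forall_inP H1) /and3P[cab _ /eqP].
- move=> p; move/forallP/(_ p)/card_set_ex1: H2 => [[a b]].
  rewrite !inE /= => /andP[abT /eqP eq_b] H; rewrite eq_b in abT H.
  by exists a => // a' a'T; have := H (a', inhat p); rewrite !inE a'T eqxx => /(_ isT)[].
- apply/forall_inP=> -[a b] /H1 [/= cab /eqP ->]; rewrite cab andbT /=.
  by apply: contraTneq cab => ->; rewrite covers_htop.
- apply/forallP=> p; apply/card_set_ex1; have [a aT H] := H2 p.
  exists (a, inhat p); first by rewrite !inE aT eqxx.
  by move=> [a' b]; rewrite !inE /= => /andP[+ /eqP eq_b]; rewrite eq_b => /H ->.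
Qed.

Lemma down_arbP T :
  reflect ((forall a b, (a, b) \in T -> covers a b /\ a <> hbot) /\
           (forall p, exists2 b, (inhat p, b) \in T &
                        forall b', (inhat p, b') \in T -> b' = b))
          (T \in down_arborescences S).
Proof.
rewrite inE; apply: (iffP andP) => -[H1 H2]; split.
- by move=> a b /(forall_inP H1) /and3P[cab /eqP].
- move=> p; move/forallP/(_ p)/card_set_ex1: H2 => [[a b]].
  rewrite !inE /= => /andP[abT /eqP eq_a] H; rewrite eq_a in abT H.
  by exists b => // b' b'T; have := H (inhat p, b'); rewrite !inE b'T eqxx => /(_ isT)[].
- apply/forall_inP=> -[a b] /H1 [/= cab /eqP ->]; rewrite cab /=.
  by apply: contraTneq cab => ->; rewrite covers_hbot.
- apply/forallP=> p; apply/card_set_ex1; have [b bT H] := H2 p.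
  exists (inhat p, b); first by rewrite !inE bT eqxx.
  by move=> [a b']; rewrite !inE /= => /andP[+ /eqP eq_a]; rewrite eq_a => /H ->.
Qed.

(** Both sets contain exactly one edge going up from each element, so an inclusion leaves no room
    for another edge. *)
Lemma down_arb_sub_eq T1 T2 :
    T1 \in down_arborescences S -> T2 \in down_arborescences S ->
  T1 \subset T2 -> T1 = T2.
Proof.
move=> /down_arbP[_ D1] /down_arbP[E2 D2] /subsetP T12.
apply/eqP; rewrite eqEsubset; apply/andP; split; apply/subsetP=> [[a b]]; first exact: T12.
move=> abT; have [cab a_bot] := E2 _ _ abT; case: a cab a_bot abT => [[p|]|] // cab _ abT.
  have [b1 b1T _] := D1 p; have [b2 _ H2] := D2 p.
  by rewrite [b](H2 b abT) -(H2 b1 (T12 _ b1T)).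
by rewrite covers_htop in cab.
Qed.

Definition tree_steps T : rel S := fun p q => (inhat p, inhat q) \in T.

Lemma chain_edges_sub C T :
  (chain_edges C \subset T) = steps_in (tree_steps T) C.
Proof.
apply/subsetP/steps_inP=> [H p q pC qC cpq|H e].
  by apply: H; apply/imset2P; exists p q; rewrite // inE qC.
by case/imset2P=> p q pC; rewrite inE => /andP[qC cpq] ->; apply: H.
Qed.

End HatCovers.

(** * Unit squares of the Hasse diagram and edges without alternative *)

Section TrapezoidCovers.
Variables r s : nat.
Implicit Types p q u v : RT r s.

(* Bottom, resp. top, vertex of a unit square of the Hasse diagram; all other
   elements have a unique cover, resp. cover a unique element, in [hat]. *)
Definition free_up p := (cj p < s)%N && ~~ on_left p.
Definition free_dn v := [&& (1 < ci v)%N, (1 < cj v)%N & ~~ on_left v].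
Definition diag p v := (ci v == (ci p).+1) && (cj v == (cj p).+1).

Lemma free_up_diagonal p : free_up p -> exists v, diag p v.
Proof.
case/andP=> js /negP pL; have [p1 p2 p3 p4] := RT_bounds p.
have [v [vi vj]] : exists v : RT r s, ci v = (ci p).+1 /\ cj v = (cj p).+1 by apply: RT_at; lia.
by exists v; rewrite /diag vi vj !eqxx.
Qed.

Lemma free_dn_diagonal v : free_dn v -> exists p, diag p v.
Proof.
case/and3P=> i1 j1 /negP pL; have [p1 p2 p3 p4] := RT_bounds v.
have [p [pi pj]] : exists p : RT r s, ci p = (ci v).-1 /\ cj p = (cj v).-1 by apply: RT_at; lia.
by exists p; rewrite /diag pi pj; lia.
Qed.

Lemma diag_inj_up p v v' : diag p v -> diag p v' -> v = v'.
Proof. by move=> /andP[/eqP ? /eqP ?] /andP[/eqP ? /eqP ?]; apply: RT_inj; lia. Qed.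

Lemma diag_inj_dn p p' v : diag p v -> diag p' v -> p = p'.
Proof. by move=> /andP[/eqP ? /eqP ?] /andP[/eqP ? /eqP ?]; apply: RT_inj; lia. Qed.

Lemma diag_free p v : diag p v -> free_up p = free_dn v.
Proof.
move=> /andP[/eqP vi /eqP vj]; have [p1 p2 p3 p4] := RT_bounds p.
have [v1 v2 v3 v4] := RT_bounds v; rewrite /free_up /free_dn /on_left; lia.
Qed.

Lemma diag_covers p q v : diag p v -> covers p q = covers q v.
Proof.
move=> /andP[/eqP vi /eqP vj]; apply/RT_coversP/RT_coversP; lia.
Qed.

Lemma diag_middles p v : diag p v -> free_up p -> exists q1 q2,
  [/\ q1 != q2, covers p q1, covers p q2 & forall q, covers p q -> q = q1 \/ q = q2].
Proof.
move=> /andP[/eqP vi /eqP vj] /andP[js /negP pL]; have [p1 p2 p3 p4] := RT_bounds p.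
have [q1 [q1i q1j]] : exists v : RT r s, ci v = (ci p).+1 /\ cj v = cj p.
  by move: pL; rewrite /on_left => pL; apply: RT_at; lia.
have [q2 [q2i q2j]] : exists v : RT r s, ci v = ci p /\ cj v = (cj p).+1 by apply: RT_at; lia.
exists q1, q2; split; first by apply/eqP=> eq_q; move: q2i; rewrite -eq_q q1i; lia.
- by apply/RT_coversP; left.
- by apply/RT_coversP; right.
by move=> q /RT_coversP[] [qi qj]; [left|right]; apply: RT_inj; lia.
Qed.

Lemma covers_hatP p (b : hat (RT r s)) : covers (inhat p) b ->
  (exists2 q, b = inhat q & covers p q) \/ [/\ b = htop, cj p = s & on_left p].
Proof.
case: b => [[q|]|] cpb; last by rewrite covers_hbot in cpb.
  by left; exists q => //; rewrite -hat_covers.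
right; move/hat_covers_top: cpb => top_p; have [p1 p2 p3 p4] := RT_bounds p.
have no_cover q : ~~ covers p q by apply/negP=> /covers_lt /top_p.
have js : cj p = s.
  have [//|neq_js] := eqVneq (cj p) s.
  have [q [qi qj]] : exists q : RT r s, ci q = ci p /\ cj q = (cj p).+1 by apply: RT_at; lia.
  by case/RT_coversP: (no_cover q); right.
split=> //; apply: contraT => /negP; rewrite /on_left => pL.
have [q [qi qj]] : exists q : RT r s, ci q = (ci p).+1 /\ cj q = cj p by apply: RT_at; lia.
by case/RT_coversP: (no_cover q); left.
Qed.

Lemma covered_hatP v (a : hat (RT r s)) : (0 < r)%N -> covers a (inhat v) ->
  (exists2 q, a = inhat q & covers q v) \/ [/\ a = hbot, ci v = 1%N & cj v = 1%N].
Proof.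
move=> r_gt0; case: a => [[q|]|] cav; last first.
- right; move/hat_covers_bot: cav => bot_v; have [p1 p2 p3 p4] := RT_bounds v.
  have no_cover q : ~~ covers q v by apply/negP=> /covers_lt /bot_v.
  have i1 : ci v = 1%N.
    have [//|neq_i1] := eqVneq (ci v) 1%N.
    have [q [qi qj]] : exists q : RT r s, ci q = (ci v).-1 /\ cj q = cj v by apply: RT_at; lia.
    by case/RT_coversP: (no_cover q); left; lia.
  split=> //; have [//|neq_j1] := eqVneq (cj v) 1%N.
  have [q [qi qj]] : exists q : RT r s, ci q = ci v /\ cj q = (cj v).-1 by apply: RT_at; lia.
  by case/RT_coversP: (no_cover q); right; lia.
- by rewrite covers_htop in cav.
- by left; exists q => //; rewrite -hat_covers.
Qed.

(** On the top row a step in direction j leaves the trapezoid, on the left border a step in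
    direction i does; where both hold, only the new maximum remains. *)
Lemma hat_upper_unique p (a b : hat (RT r s)) :
  ~~ free_up p -> covers (inhat p) a -> covers (inhat p) b -> a = b.
Proof.
rewrite /free_up /on_left => pF /covers_hatP Ha /covers_hatP Hb.
have [p1 p2 p3 p4] := RT_bounds p.
case: Ha Hb => [[q -> /RT_coversP cq]|[-> js /eqP pL]] [[q' -> /RT_coversP cq']|[-> js' /eqP pL']] //.
- have [[q1 q2 q3 q4] [q'1 q'2 q'3 q'4]] := (RT_bounds q, RT_bounds q').
  by congr inhat; apply: RT_inj; lia.
- by have [q1 q2 q3 q4] := RT_bounds q; lia.
- by have [q1 q2 q3 q4] := RT_bounds q'; lia.
Qed.

Lemma hat_lower_unique v (a b : hat (RT r s)) : (0 < r)%N ->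
  ~~ free_dn v -> covers a (inhat v) -> covers b (inhat v) -> a = b.
Proof.
rewrite /free_dn /on_left => r_gt0 vF /(covered_hatP r_gt0) Ha /(covered_hatP r_gt0) Hb.
have [p1 p2 p3 p4] := RT_bounds v.
case: Ha Hb => [[q -> /RT_coversP cq]|[-> vi vj]] [[q' -> /RT_coversP cq']|[-> vi' vj']] //.
- have [[q1 q2 q3 q4] [q'1 q'2 q'3 q'4]] := (RT_bounds q, RT_bounds q').
  by congr inhat; apply: RT_inj; lia.
- by have [q1 q2 q3 q4] := RT_bounds q; lia.
- by have [q1 q2 q3 q4] := RT_bounds q'; lia.
Qed.

Lemma hat_upper_exists p : exists b, covers (inhat p) b.
Proof.
have [p1 p2 p3 p4] := RT_bounds p.
have [js|js] := eqVneq (cj p) s; last first.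
  have [q [qi qj]] : exists q : RT r s, ci q = ci p /\ cj q = (cj p).+1 by apply: RT_at; lia.
  by exists (inhat q); rewrite hat_covers; apply/RT_coversP; right.
have [/eqP pL|/negP] := boolP (on_left p); last first.
  rewrite /on_left => pL.
  have [q [qi qj]] : exists q : RT r s, ci q = (ci p).+1 /\ cj q = cj p by apply: RT_at; lia.
  by exists (inhat q); rewrite hat_covers; apply/RT_coversP; left.
exists htop; apply/hat_covers_top => q; rewrite lt_neqAle RT_leE => /andP[/eqP neq_pq le_pq].
by have [q1 q2 q3 q4] := RT_bounds q; apply: neq_pq; apply: RT_inj; lia.
Qed.

Lemma hat_lower_exists v : (0 < r)%N -> exists a, covers a (inhat v).
Proof.
move=> r_gt0; have [p1 p2 p3 p4] := RT_bounds v.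
have [i1|i1] := eqVneq (ci v) 1%N; last first.
  have [q [qi qj]] : exists q : RT r s, ci q = (ci v).-1 /\ cj q = cj v by apply: RT_at; lia.
  by exists (inhat q); rewrite hat_covers; apply/RT_coversP; left; lia.
have [j1|j1] := eqVneq (cj v) 1%N; last first.
  have [q [qi qj]] : exists q : RT r s, ci q = ci v /\ cj q = (cj v).-1 by apply: RT_at; lia.
  by exists (inhat q); rewrite hat_covers; apply/RT_coversP; right; lia.
exists hbot; apply/hat_covers_bot => q; rewrite lt_neqAle RT_leE => /andP[/eqP neq_pq le_pq].
by have [q1 q2 q3 q4] := RT_bounds q; apply: neq_pq; apply: RT_inj; lia.
Qed.

Lemma forced_edgesE p b :
  ((inhat p, b) \in forced_edges (RT r s)) = covers (inhat p) b && ~~ free_up p.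
Proof.
rewrite inE; apply/existsP/andP=> [[p' /andP[/eqP[eq_p] /eqP covp]]|[cpb pF]]; last first.
  exists p; rewrite eqxx; apply/eqP/setP=> a; rewrite !inE /=.
  by apply/idP/eqP=> [cpa|->//]; apply: hat_upper_unique pF cpa cpb.
move: covp; rewrite -eq_p /= => /setP covp; split.
  by have := covp b; rewrite !inE eqxx.
apply/negP=> pF; have [v pv] := free_up_diagonal pF.
have [q1 [q2 [neq_q c1 c2 _]]] := diag_middles pv pF.
have := covp (inhat q1); have := covp (inhat q2); rewrite !inE !hat_covers c1 c2.
by move=> /esym/eqP <- /esym/eqP/inhat_inj eq_q; rewrite eq_q eqxx in neq_q.
Qed.

End TrapezoidCovers.

(** * From intersecting segments to corners of a unit square *)

Section Aleph.
Variables (R : realType) (r s : nat).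
Implicit Types (p q u v : RT r s) (T : {set edge (RT r s)}).

(* The shifted edge [u v] crosses [p q] exactly when [p], [q] = [u], [v] run
   through three corners of a unit square. *)
Lemma segments_meet p q u v : covers p q -> covers u v ->
  ((exists w, segment (drawn_at R p) (drawn_at R q) w /\
      shifted (segment (drawn_at R u) (drawn_at R v)) w) <->
   (u = q /\ diag p v)).
Proof.
move=> /RT_coversP cpq /RT_coversP cuv; rewrite /diag.
(* The shift creates half-integers; doubled inequalities can be moved from the reals to the
   naturals. *)
have double_nat (a b c e : nat) : ((a%:R : R) + a%:R + c%:R <= b%:R + b%:R + e%:R)%R ->
    (a + a + c <= b + b + e)%N.
  by rewrite -!natrD ler_nat.
have ciS (u' : RT r s) : ((ci u').+1%:R : R)%R = ((ci u')%:R + 1)%R by rewrite natr1.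
have cjS (u' : RT r s) : ((cj u').+1%:R : R)%R = ((cj u')%:R + 1)%R by rewrite natr1.
split.
  case=> -[w1 w2] [[t + [eq1 eq2]] [[z1 z2] [t' + [eq3 eq4]] [eq5 eq6]]].
  move: eq1 eq2 eq3 eq4 eq5 eq6.
  rewrite /= !in_itv /line_path /= => eq1 eq2 eq3 eq4 eq5 eq6 /andP[t0 t1] /andP[t'0 t'1].
  case: cpq cuv => [] [qi qj] [] [vi vj]; rewrite ?qi ?qj ?vi ?vj ?ciS ?cjS in eq1 eq2 eq3 eq4.
    (* Parallel edges: a common point would make an even number equal to an odd one. *)
    - have := double_nat (cj p) (cj u) 1 0 ltac:(lra).
    have := double_nat (cj u) (cj p) 0 1 ltac:(lra); lia.
  - have := double_nat (ci p) (ci u) 1 0 ltac:(lra).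
    have := double_nat (ci u) (ci p) 0 3 ltac:(lra).
    have := double_nat (cj p) (cj u) 0 1 ltac:(lra).
    have := double_nat (cj u) (cj p) 0 1 ltac:(lra) => *.
    by split; [apply: RT_inj|]; lia.
    - have := double_nat (cj p) (cj u) 1 0 ltac:(lra).
    have := double_nat (cj u) (cj p) 0 3 ltac:(lra).
    have := double_nat (ci p) (ci u) 0 1 ltac:(lra).
    have := double_nat (ci u) (ci p) 0 1 ltac:(lra) => *.
    by split; [apply: RT_inj|]; lia.
  - have := double_nat (ci p) (ci u) 1 0 ltac:(lra).
    have := double_nat (ci u) (ci p) 0 1 ltac:(lra); lia.
case=> eq_u /andP[/eqP vi /eqP vj]; subst u.
(* The common point is the midpoint of p q, which is also the shifted midpoint of q v. *)
have half01 : ((2^-1)%R : R) \in `[0%R, 1%R] by rewrite in_itv /=; lra.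
pose w : R * R := (line_path (drawn_at R p).1 (drawn_at R q).1 (2^-1)%R,
                   line_path (drawn_at R p).2 (drawn_at R q).2 (2^-1)%R).
exists w; split; first by exists (2^-1)%R.
pose z : R * R := (line_path (drawn_at R q).1 (drawn_at R v).1 (2^-1)%R,
                   line_path (drawn_at R q).2 (drawn_at R v).2 (2^-1)%R).
exists z; first by exists (2^-1)%R.
rewrite /z /w /line_path /= vi vj; case: cpq => -[-> ->]; rewrite ?ciS ?cjS; congr (_, _); lra.
Qed.

(** Removes the geometry: the only shifted edge able to cross an edge from [p] to [q] is the one
    from [q] to the top of the square with bottom [p]. *)
Lemma alephP p b T : (forall a b, (a, b) \in T -> covers a b) ->
  ((inhat p, b) \in aleph R T) <->
  (covers (inhat p) b /\
   (free_up p -> exists q v, [/\ b = inhat q, diag p v & (inhat q, inhat v) \notin T])).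
Proof.
move=> Tcov; rewrite /aleph in_setU forced_edgesE inE; split.
  case/orP=> [/existsP[p' /existsP[q /and3P[/eqP[<- ->] cpq /asboolP disj]]]|/andP[-> pF]]; last first.
    by split=> // pF'; rewrite pF' in pF.
  rewrite hat_covers; split=> // pF; have [v pv] := free_up_diagonal pF.
  exists q, v; split=> //; apply/negP=> qvT.
  have cqv : covers q v by rewrite -(diag_covers _ pv).
  have [_ /(_ (conj erefl pv)) [w [w1 w2]]] := segments_meet cpq cqv.
  have : (classical_sets.set0 : set (R * R)) w; last by [].
  rewrite -disj; split=> //; case: w2 => w' w'seg <-; exists w' => //=.
  by exists q, v.
case=> cpb; have [pF|_ _] := boolP (free_up p); last by rewrite cpb orbT.
move=> /(_ isT) [q [v [eq_b pv qvT]]]; rewrite andbF orbF eq_b.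
rewrite eq_b hat_covers in cpb.
apply/existsP; exists p; apply/existsP; exists q; rewrite eqxx cpb /=; apply/asboolP.
apply/seteqP; split=> // w [w1 [w' [u [v' [uvT w'seg]] eqw]]].
have cuv : covers u v' by rewrite -hat_covers; apply: Tcov.
have [|eq_u pv'] := (segments_meet cpb cuv).1; first by exists w; split=> //; exists w'.
by move: qvT; rewrite -eq_u (diag_inj_up pv pv') uvT.
Qed.

End Aleph.

(** * The bijection aleph *)

Section AlephBijection.
Variables (R : realType) (r s : nat).
Hypothesis r_gt0 : (0 < r)%N.
Implicit Types (p q u v : RT r s) (T : {set edge (RT r s)}).

(** At the top of each square [T] descends to exactly one of the two middle corners; the bottom then
    keeps exactly the edge to the other one. *)
Lemma aleph_down_arb T :
  T \in up_arborescences (RT r s) -> aleph R T \in down_arborescences (RT r s).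
Proof.
move=> /up_arbP[E_T U_T]; have Tcov a b : (a, b) \in T -> covers a b by move=> /E_T[].
apply/down_arbP; split.
  move=> a b; rewrite /aleph in_setU => /orP[].
    by rewrite inE => /existsP[p /existsP[q /and3P[/eqP[-> ->] cpq _]]]; rewrite hat_covers.
  rewrite inE => /existsP[p /andP[/eqP/= -> /eqP/setP/(_ b)]].
  by rewrite !inE eqxx => ->.
move=> p; have [pF|pF] := boolP (free_up p); last first.
  have [b cpb] := hat_upper_exists p; exists b.
    by apply/(alephP R p b Tcov); split=> // pF'; rewrite pF' in pF.
  by move=> b' /(alephP R p b' Tcov)[cpb' _]; apply: hat_upper_unique pF cpb' cpb.
have [v pv] := free_up_diagonal pF.
have [q1 [q2 [neq_q c1 c2 q12]]] := diag_middles pv pF.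
have cv q : (inhat q, inhat v) \in T -> q = q1 \/ q = q2.
  by move=> /Tcov; rewrite hat_covers -(diag_covers _ pv) => /q12.
have [a avT a_uniq] := U_T v.
have [[q eq_a _]|[_ vi vj]] := covered_hatP r_gt0 (Tcov _ _ avT); last first.
  by move: pF; rewrite (diag_free pv) /free_dn vi vj.
rewrite {}eq_a in avT a_uniq.
have out q' : q' != q -> (inhat q', inhat v) \notin T.
  by apply: contraNN => /a_uniq/inhat_inj ->.
have mem b : (inhat p, b) \in aleph R T <-> exists q', [/\ b = inhat q', covers p q' & q' != q].
  split=> [/(alephP R p b Tcov)[cpb /(_ pF) [q' [v' [eq_b pv' q'T]]]]|[q' [-> cpq' neq_q']]].
    exists q'; rewrite -hat_covers -eq_b; split=> //; apply: contraNneq q'T => ->.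
    by rewrite (diag_inj_up pv' pv).
  apply/(alephP R p (inhat q') Tcov); split; first by rewrite hat_covers.
  by move=> _; exists q', v; split=> //; apply: out.
case: (cv q avT) => eq_q; [exists (inhat q2)|exists (inhat q1)].
- by apply/mem; exists q2; rewrite eq_q eq_sym.
- by move=> b' /mem [q' [-> /q12[->|->//]]]; rewrite eq_q eqxx.
- by apply/mem; exists q1; rewrite eq_q.
- by move=> b' /mem [q' [-> /q12[->//|->]]]; rewrite eq_q eqxx.
Qed.

(** An edge q v of one tree missing from the other would leave the edge p q in the second image, yet
    it crosses p q in the first. Where [v] tops no square, all upward arborescences agree. *)
Lemma aleph_inj : {in up_arborescences (RT r s) &, injective (@aleph R r s)}.
Proof.
suff sub T1 T2 : T1 \in up_arborescences (RT r s) -> T2 \in up_arborescences (RT r s) ->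
    aleph R T1 = aleph R T2 -> T1 \subset T2.
  by move=> T1 T2 U1 U2 eqT; apply/eqP; rewrite eqEsubset !sub.
move=> /up_arbP[E1 _] /up_arbP[E2 U2] eqT; apply/subsetP=> -[a b] abT.
have T1cov a' b' : (a', b') \in T1 -> covers a' b' by move=> /E1[].
have T2cov a' b' : (a', b') \in T2 -> covers a' b' by move=> /E2[].
have [cab b_top] := E1 _ _ abT; case: b cab b_top abT => [[v|]|] // cab _ abT; last first.
  by rewrite covers_hbot in cab.
have [a' a'T a'_uniq] := U2 v.
have [vF|vF] := boolP (free_dn v); last first.
  by rewrite (hat_lower_unique r_gt0 vF cab (T2cov _ _ a'T)).
have [p pv] := free_dn_diagonal vF; have pF : free_up p by rewrite (diag_free pv).
have [[q eq_a cqv]|[_ vi vj]] := covered_hatP r_gt0 cab; last first.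
  by move: vF; rewrite /free_dn vi vj.
apply: contraT => aT2; rewrite {}eq_a in abT aT2.
have /(alephP R p (inhat q) T1cov)[_ /(_ pF)[q' [v' [/inhat_inj <- pv']]]] :
    (inhat p, inhat q) \in aleph R T1.
  rewrite eqT; apply/(alephP R p (inhat q) T2cov); rewrite hat_covers (diag_covers _ pv).
  by split=> // _; exists q, v.
by rewrite (diag_inj_up pv' pv) abT.
Qed.

Definition aleph_inv T : {set edge (RT r s)} :=
  [set e : edge (RT r s) | [&& covers e.1 e.2, e.2 != htop &
     [forall p : RT r s, forall q : RT r s, forall v : RT r s,
        [&& free_up p, diag p v & e == (inhat q, inhat v)] ==>
        ((inhat p, inhat q) \notin T)]]]%SET.

Lemma aleph_invP a v T :
  (a, inhat v) \in aleph_inv T <->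
  covers a (inhat v) /\ (forall p q, free_up p -> diag p v -> a = inhat q ->
                          (inhat p, inhat q) \notin T).
Proof.
rewrite inE /=; split=> [/andP[cav H]|[-> H] /=].
  split=> // p q pF pv eq_a.
  move/forallP/(_ p)/forallP/(_ q)/forallP/(_ v): H.
  by rewrite pF pv eq_a eqxx.
apply/forallP=> p; apply/forallP=> q; apply/forallP=> v'; apply/implyP.
by move=> /and3P[pF pv' /eqP[eq_a eq_v]]; apply: H; rewrite // eq_v.
Qed.

Lemma aleph_inv_up_arb T :
  T \in down_arborescences (RT r s) -> aleph_inv T \in up_arborescences (RT r s).
Proof.
move=> /down_arbP[E_T D_T]; apply/up_arbP; split.
  by move=> a b; rewrite inE => /and3P[? /eqP].
move=> v; have [vF|vF] := boolP (free_dn v); last first.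
  have [a cav] := hat_lower_exists v r_gt0; exists a.
    apply/aleph_invP; split=> // p q pF pv; by rewrite -(diag_free pv) pF in vF.
  by move=> a' /aleph_invP[ca'v _]; apply: (hat_lower_unique r_gt0 vF ca'v cav).
have [p pv] := free_dn_diagonal vF; have pF : free_up p by rewrite (diag_free pv).
have [q1 [q2 [neq_q c1 c2 q12]]] := diag_middles pv pF.
have [b pbT b_uniq] := D_T p; have [cpb _] := E_T _ _ pbT.
have [[q eq_b cpq]|[_ js pL]] := covers_hatP cpb; last first.
  by case/andP: pF; rewrite pL.
rewrite {}eq_b in pbT b_uniq.
have mem a : (a, inhat v) \in aleph_inv T <-> exists q', [/\ a = inhat q', covers p q' & q' != q].
  split=> [/aleph_invP[cav H]|[q' [-> cpq' neq_q']]].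
    have [[q' eq_a cqv]|[_ vi vj]] := covered_hatP r_gt0 cav; last first.
      by move: vF; rewrite /free_dn vi vj.
    exists q'; rewrite (diag_covers _ pv); split=> //.
    by have := H p q' pF pv eq_a; apply: contraNneq => ->.
  apply/aleph_invP; rewrite hat_covers -(diag_covers _ pv); split=> // p' q'' _ p'v /inhat_inj <-.
  rewrite (diag_inj_dn p'v pv); apply: contraNN neq_q' => /b_uniq/inhat_inj ->.
  exact: eqxx.
case: (q12 q cpq) => eq_q; [exists (inhat q2)|exists (inhat q1)].
- by apply/mem; exists q2; rewrite eq_q eq_sym.
- by move=> a' /mem [q' [-> /q12[->|->//]]]; rewrite eq_q eqxx.
- by apply/mem; exists q1; rewrite eq_q.
- by move=> a' /mem [q' [-> /q12[->//|->]]]; rewrite eq_q eqxx.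
Qed.

Lemma aleph_invK T : T \in down_arborescences (RT r s) -> aleph R (aleph_inv T) = T.
Proof.
move=> DT; have UT := aleph_inv_up_arb DT.
apply/esym/down_arb_sub_eq => //; first exact: aleph_down_arb.
case/down_arbP: DT => E_T D_T; apply/subsetP=> -[a b] abT.
have [cab a_bot] := E_T _ _ abT; case: a cab a_bot abT => [[p|]|] // cab _ abT; last first.
  by rewrite covers_htop in cab.
have cov a' b' : (a', b') \in aleph_inv T -> covers a' b' by rewrite inE => /and3P[].
apply/(alephP R p b cov); split=> // pF; have [v pv] := free_up_diagonal pF.
have [[q eq_b cpq]|[_ js pL]] := covers_hatP cab; last first.
  by case/andP: pF; rewrite pL.
exists q, v; split=> //; rewrite eq_b in abT.
by apply/negP=> /aleph_invP[_ /(_ p q pF pv erefl)]; rewrite abT.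
Qed.

(** Brings the union over chains into the form of [through_left_duality]. *)
Lemma up_arb_containingP m M T : reflect
    (T \in up_arborescences (RT r s) /\
     exists l, [/\ on_left l, connect (tree_steps T) m l & connect (tree_steps T) l M])
    (T \in up_arb_containing (chains_L m M)).
Proof.
apply: (iffP bigcupP) => [[C]|[UT [l [lL ml lM]]]].
  rewrite inE => /andP[CC /pred0Pn[l /andP[/= lC]]]; rewrite left_borderE => lL.
  rewrite inE => /andP[UT sub]; split=> //; exists l.
  have T_cov p q : tree_steps T p q -> covers p q.
    by case/up_arbP: UT => E _ /E[]; rewrite hat_covers.
  have [] : connect (tree_steps T) m l /\ connect (tree_steps T) l M; last by [].
  by apply/(connect_chain_through T_cov); exists C; split; rewrite // -chain_edges_sub.
have T_cov p q : tree_steps T p q -> covers p q.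
  by case/up_arbP: UT => E _ /E[]; rewrite hat_covers.
have [C [CC lC eC]] := (connect_chain_through T_cov m l M).2 (conj ml lM).
exists C; last by rewrite inE UT chain_edges_sub.
by rewrite inE CC; apply/pred0Pn; exists l; rewrite /= lC left_borderE.
Qed.

Lemma down_arb_containingP m M T : reflect
    (T \in down_arborescences (RT r s) /\
     exists l, [/\ on_left l, connect (tree_steps T) m l & connect (tree_steps T) l M])
    (T \in down_arb_containing (chains_L m M)).
Proof.
apply: (iffP bigcupP) => [[C]|[UT [l [lL ml lM]]]].
  rewrite inE => /andP[CC /pred0Pn[l /andP[/= lC]]]; rewrite left_borderE => lL.
  rewrite inE => /andP[UT sub]; split=> //; exists l.
  have T_cov p q : tree_steps T p q -> covers p q.
    by case/down_arbP: UT => E _ /E[]; rewrite hat_covers.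
  have [] : connect (tree_steps T) m l /\ connect (tree_steps T) l M; last by [].
  by apply/(connect_chain_through T_cov); exists C; split; rewrite // -chain_edges_sub.
have T_cov p q : tree_steps T p q -> covers p q.
  by case/down_arbP: UT => E _ /E[]; rewrite hat_covers.
have [C [CC lC eC]] := (connect_chain_through T_cov m l M).2 (conj ml lM).
exists C; last by rewrite inE UT chain_edges_sub.
by rewrite inE CC; apply/pred0Pn; exists l; rewrite /= lC left_borderE.
Qed.

Section Containing.
Variables m' m M' M : RT r s.
Hypothesis (mi : ci m = 1%N) (m'i : ci m' = 1%N) (mj : cj m = (cj m').+1).
Hypothesis (Mj : cj M = s) (M'j : cj M' = s) (Mi : ci M = (ci M').+1).

Lemma aleph_containing T : T \in up_arborescences (RT r s) ->
  (T \in up_arb_containing (chains_L m M)) =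
  (aleph R T \in down_arb_containing (chains_L m' M')).
Proof.
move=> UT; have DT := aleph_down_arb UT.
have [E_T U_T] := up_arbP _ UT; have [E_D D_D] := down_arbP _ DT.
have Tcov a b : (a, b) \in T -> covers a b by move=> /E_T[].
have [] := @through_left_duality r s (tree_steps T) (tree_steps (aleph R T)) _ _ _ _ _
  m' m M' M mi m'i mj Mj M'j Mi.
- by move=> p q /E_T[]; rewrite hat_covers.
- by move=> p q /E_D[]; rewrite hat_covers.
- move=> v v11; have [a avT _] := U_T v.
  have [[q eq_a _]|[_ i1 j1]] := covered_hatP r_gt0 (Tcov _ _ avT); last by case: v11.
  by exists q; rewrite /tree_steps -eq_a.
- move=> p p_top; have [b pbT _] := D_D p; have [cpb _] := E_D _ _ pbT.
  have [[q eq_b _]|[_ js pL]] := covers_hatP cpb; last by case: p_top.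
  by exists q; rewrite /tree_steps -eq_b.
(* Non-crossing is the criterion of [alephP]: off the left border, p q survives only if [T] omits q
   v. *)
- move=> p q v /(alephP R p (inhat q) Tcov)[_ pF] qvT vi vj.
  apply: contraT => pL; have [v1 v2 v3 v4] := RT_bounds v.
  have [|q' [v' [/inhat_inj <- pv']]] := pF; first by rewrite /free_up pL; lia.
  have pv : diag p v by rewrite /diag vi vj !eqxx.
  by rewrite -(diag_inj_up pv pv') => /negP; case.
move=> H1 H2; apply/up_arb_containingP/down_arb_containingP => -[_ H]; split=> //; auto.
Qed.

Lemma aleph_restricts :
  {in up_arb_containing (chains_L m M) &, injective (@aleph R r s)} /\
  (@aleph R r s @: up_arb_containing (chains_L m M))%SET = down_arb_containing (chains_L m' M').
Proof.
have sub T : T \in up_arb_containing (chains_L m M) -> T \in up_arborescences (RT r s).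
  by case/up_arb_containingP.
split; first by move=> T1 T2 /sub U1 /sub U2; apply: aleph_inj.
apply/setP=> T'; apply/imsetP/idP=> [[T TU ->]|DT'].
  by rewrite -aleph_containing // sub.
have D : T' \in down_arborescences (RT r s) by case/down_arb_containingP: DT'.
by exists (aleph_inv T'); rewrite ?aleph_invK // aleph_containing ?aleph_invK // aleph_inv_up_arb.
Qed.

End Containing.
End AlephBijection.

(** * Random walks *)

Section MultiAffine.
Variables (R : realType) (I : finType).
Implicit Types (t : {ffun I -> R}) (F G : {ffun I -> R} -> R).
Local Open Scope ring_scope.

Definition update t i c : {ffun I -> R} := [ffun j => if j == i then c else t j].

Definition multiaffine F :=
  forall t i, F t = t i * F (update t i 1) + (1 - t i) * F (update t i 0).

(** Induction on the number of coordinates different from 0 and 1: expanding along one of them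
    lowers that number. *)
Lemma multiaffine_eq F G : multiaffine F -> multiaffine G ->
    (forall t, (forall i, t i = 0 \/ t i = 1) -> F t = G t) ->
  F =1 G.
Proof.
move=> aF aG FG t.
have [n] := ubnP #|[set i | (t i != 0) && (t i != 1)]%SET|; elim: n t => // n IHn t lt_n.
have [i|no_i] := pickP [pred i | (t i != 0) && (t i != 1)]; last first.
  by apply: FG => i; have /= := no_i i; do 2?case: eqP; auto.
move=> /= i_in; rewrite (aF t i) (aG t i).
have upd c : c = 0 \/ c = 1 -> F (update t i c) = G (update t i c).
  move=> c01; apply: IHn; rewrite -ltnS; apply: leq_trans lt_n.
  rewrite ltnS; apply: proper_card; apply/properP; split.
    apply/subsetP=> j; rewrite !inE ffunE; case: (j == i) => //.
    by case: c01 => ->; rewrite eqxx ?andbF.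
  exists i; rewrite !inE ?i_in // ffunE eqxx; case: c01 => ->; by rewrite eqxx ?andbF.
by rewrite !upd //; [left|right].
Qed.

(** Each parameter enters a product through a single factor, so it suffices that every factor is
    affine. *)
Lemma multiaffine_sum_prod (J : finType) (A : {set J}) (g : I -> J -> R -> R) :
    (forall i j c, g i j c = c * g i j 1 + (1 - c) * g i j 0) ->
  multiaffine (fun t => \sum_(j in A) \prod_i g i j (t i)).
Proof.
move=> ag t i; rewrite !mulr_sumr -big_split /=; apply: eq_bigr => j _.
rewrite (bigD1 i) //= [X in _ = _ * X + _](bigD1 i) //= [X in _ + _ * X](bigD1 i) //=.
rewrite !ffunE eqxx (ag i j (t i)) mulrDl -!mulrA.
by congr (_ * (_ * _) + _ * (_ * _)); apply: eq_bigr => k neq_k; rewrite ffunE (negbTE neq_k).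
Qed.

End MultiAffine.

(** * One factor per unit square, and deterministic walks for 0/1 parameters *)

Section StepFactors.
Variables (R : realType) (r s : nat).
Implicit Types (p q u v y : RT r s) (C : {set RT r s}) (t : {ffun RT r s -> R}).
Local Open Scope ring_scope.

(* The probability contributed by the unit square with top [v] to a walk down,
   resp. up, along [C], when [c] is the probability of a step in direction i. *)
Definition down_factor v C (c : R) : R :=
  if free_dn v && (v \in C) then
    if [exists q in C, (ci q < ci v)%N && covers q v] then c else 1 - c
  else 1.

Definition up_factor v C (c : R) : R :=
  if free_dn v && [exists p in C, diag p v] then
    if [exists q in C, (ci q == ci v)%N && covers q v] then c else 1 - c
  else 1.

Lemma down_factor_affine v C c :
  down_factor v C c = c * down_factor v C 1 + (1 - c) * down_factor v C 0.
Proof. by rewrite /down_factor; do 2?case: ifP => _; ring. Qed.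

Lemma up_factor_affine v C c :
  up_factor v C c = c * up_factor v C 1 + (1 - c) * up_factor v C 0.
Proof. by rewrite /up_factor; do 2?case: ifP => _; ring. Qed.

Lemma covers_eq_dir y y' v :
  covers y v -> covers y' v -> (ci y < ci v)%N = (ci y' < ci v)%N -> y = y'.
Proof. by move=> /RT_coversP ? /RT_coversP ? ?; apply: RT_inj; lia. Qed.

Lemma comparable_covers_eq y y' v :
  covers y v -> covers y' v -> (y >=< y')%O -> y = y'.
Proof.
move=> cy cy' /orP[]; rewrite le_eqVlt => /orP[/eqP//|lt_yy'].
  by case/coversP: cy => _ /(_ y' lt_yy' (covers_lt cy')).
by case/coversP: cy' => _ /(_ y lt_yy' (covers_lt cy)).
Qed.

Lemma down_factor_cover C y v c : {in C &, forall p q, (p >=< q)%O} ->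
    y \in C -> v \in C -> covers y v -> free_dn v ->
  down_factor v C c = if (ci y < ci v)%N then c else 1 - c.
Proof.
move=> chC yC vC cyv vF; rewrite /down_factor vF vC /=.
suff -> : [exists q in C, (ci q < ci v)%N && covers q v] = (ci y < ci v)%N by [].
apply/existsP/idP=> [[q /and3P[qC lt_qv cqv]]|lt_yv]; last by exists y; rewrite yC lt_yv.
by rewrite (comparable_covers_eq cyv cqv (chC _ _ yC qC)).
Qed.

Lemma up_factor_cover C p q v c : {in C &, forall p q, (p >=< q)%O} ->
    p \in C -> q \in C -> covers p q -> diag p v -> free_dn v ->
  up_factor v C c = if (ci p < ci q)%N then c else 1 - c.
Proof.
move=> chC pC qC cpq pv vF; have cqv : covers q v by rewrite -(diag_covers _ pv).
(* A step up from the bottom in direction i ends at the corner sharing its first coordinate with the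
   top, hence the test in [up_factor]. *)
have -> : (ci p < ci q)%N = (ci q == ci v).
  by case/andP: pv => /eqP vi /eqP vj; case/RT_coversP: cpq; case/RT_coversP: cqv; lia.
rewrite /up_factor vF /=; have -> : [exists p in C, diag p v].
  by apply/existsP; exists p; rewrite pC.
suff -> : [exists q in C, (ci q == ci v)%N && covers q v] = (ci q == ci v) by [].
apply/existsP/idP=> [[u /and3P[uC eq_uv cuv]]|eq_qv]; last by exists q; rewrite qC eq_qv.
by rewrite (comparable_covers_eq cqv cuv (chC _ _ qC uC)).
Qed.

(** The value 1 at the top of a square selects direction i and 0 selects direction j; elsewhere the
    step is forced. [up_choice] reads the same value, which is stored at the top of the square above
    [p]. *)
Definition down_choice t : rel (RT r s) := fun p v =>
  covers p v && (free_dn v ==> (t v == (ci p < ci v)%:R)).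

Definition up_choice t : rel (RT r s) := fun p q =>
  covers p q && [forall v, free_dn v && diag p v ==> (t v == (ci p < ci q)%:R)].

Lemma down_choice_covers t p q : down_choice t p q -> covers p q.
Proof. by case/andP. Qed.

Lemma up_choice_covers t p q : up_choice t p q -> covers p q.
Proof. by case/andP. Qed.

Lemma factor01 (b : bool) (c : R) : c = 0 \/ c = 1 ->
  (if b then c else 1 - c) = (c == b%:R)%:R.
Proof.
by case=> ->; case: b; rewrite ?subr0 ?subrr ?eqxx // ?oner_eq0 // eq_sym oner_eq0.
Qed.

Lemma bool_natr_inj (b1 b2 : bool) : (b1%:R = b2%:R :> R) -> b1 = b2.
Proof. by case: b1; case: b2 => //= /eqP; rewrite eqr_nat. Qed.

Section ZeroOne.
Variable t : {ffun RT r s -> R}.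
Hypothesis t01 : forall v, t v = 0 \/ t v = 1.

(** For 0/1 parameters each factor is the indicator that one step of the chain is the chosen one. As
    [m] has first coordinate 1 it tops no square, so every top of a square in [C] has a step of [C]
    below it. *)
Lemma prod_down_factor m M C : ci m = 1%N -> C \in chains_between m M ->
  \prod_v down_factor v C (t v) = (steps_in (down_choice t) C)%:R.
Proof.
move=> mi CC; have chC := chain_comparable CC.
have factor y v : y \in C -> v \in C -> covers y v -> free_dn v ->
    down_factor v C (t v) = (t v == (ci y < ci v)%:R)%:R.
  by move=> yC vC cyv vF; rewrite (down_factor_cover _ chC yC) // factor01.
have [/steps_inP eC|nC] := boolP (steps_in _ C).
  rewrite big1 // => v _; have [/andP[vF vC]|nv] := boolP (free_dn v && (v \in C)); last first.
    by rewrite /down_factor (negbTE nv).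
  have neq_vm : v != m by apply: contraTneq vF => ->; rewrite /free_dn mi.
  have [y yC cyv] := chain_pred CC vC neq_vm.
  by rewrite (factor y) //; have /andP[_] := eC y v yC vC cyv; rewrite vF /= => ->.
have [y yC [v vC [cyv nyv]]] : exists2 y, y \in C & exists2 v, v \in C &
    covers y v /\ ~~ down_choice t y v.
  case/forall_inPn: nC => y yC /forall_inPn[v vC].
  by rewrite negb_imply => /andP[cyv nyv]; exists y => //; exists v.
move: nyv; rewrite /down_choice cyv negb_imply => /andP[vF /negbTE tv].
by rewrite (bigD1 v) //= (factor y) // tv mul0r.
Qed.

Lemma prod_up_factor m M C : cj M = s -> C \in chains_between m M ->
  \prod_v up_factor v C (t v) = (steps_in (up_choice t) C)%:R.
Proof.
move=> Mj CC; have chC := chain_comparable CC.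
have factor p q v : p \in C -> q \in C -> covers p q -> diag p v -> free_dn v ->
    up_factor v C (t v) = (t v == (ci p < ci q)%:R)%:R.
  by move=> pC qC cpq pv vF; rewrite (up_factor_cover _ chC pC qC) // factor01.
have [/steps_inP eC|nC] := boolP (steps_in _ C).
  rewrite big1 // => v _.
  have [/andP[vF /existsP[p /andP[pC pv]]]|nv] :=
    boolP (free_dn v && [exists p in C, diag p v]); last first.
    by rewrite /up_factor (negbTE nv).
  have neq_pM : p != M.
    apply: contraTneq pv => ->; rewrite /diag Mj; have [v1 v2 v3 v4] := RT_bounds v; lia.
  have [q qC cpq] := chain_succ CC pC neq_pM.
  rewrite (factor p q) //; have /andP[_ /forallP/(_ v)] := eC p q pC qC cpq.
  by rewrite vF pv /= => ->.
have [p pC [q qC [cpq npq]]] : exists2 y, y \in C & exists2 v, v \in C &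
    covers y v /\ ~~ up_choice t y v.
  case/forall_inPn: nC => y yC /forall_inPn[v vC].
  by rewrite negb_imply => /andP[cyv nyv]; exists y => //; exists v.
move: npq; rewrite /up_choice cpq /= => /forallPn[v].
rewrite negb_imply => /andP[/andP[vF pv] /negbTE tv].
by rewrite (bigD1 v) //= (factor p q) // tv mul0r.
Qed.

Lemma up_choice_fun u v y : up_choice t y u -> up_choice t y v -> u = v.
Proof.
move=> /andP[cyu /forallP tu] /andP[cyv /forallP tv].
have [yF|yF] := boolP (free_up y); last first.
  by apply: inhat_inj; apply: (hat_upper_unique yF); rewrite hat_covers.
have [w yw] := free_up_diagonal yF; have wF : free_dn w by rewrite -(diag_free yw).
move: (tu w) (tv w); rewrite wF yw /= => /eqP -> /eqP eq_t.
have : (ci y < ci u)%N = (ci y < ci v)%N.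
  exact/bool_natr_inj.
by move: cyu cyv => /RT_coversP ? /RT_coversP ? ?; apply: RT_inj; lia.
Qed.

Lemma up_choice_exists p : ~ (cj p = s /\ on_left p) -> exists q, up_choice t p q.
Proof.
move=> p_top; have [pF|pF] := boolP (free_up p); last first.
  have [b cpb] := hat_upper_exists p.
  have [[q eq_b cpq]|[_ ? ?]] := covers_hatP cpb; last by case: p_top.
  exists q; rewrite /up_choice cpq; apply/forallP=> v; apply/implyP=> /andP[vF pv].
  by rewrite (diag_free pv) vF in pF.
case/andP: (pF) => js /negP pL; have [p1 p2 p3 p4] := RT_bounds p.
rewrite /on_left in pL; have [v pv] := free_up_diagonal pF.
suff [q cpq tq] : exists2 q, covers p q & t v == (ci p < ci q)%:R.
  exists q; rewrite /up_choice cpq; apply/forallP=> v'; apply/implyP=> /andP[_ pv'].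
  by rewrite (diag_inj_up pv' pv).
case: (t01 v) => ->.
  have [q [qi qj]] : exists q : RT r s, ci q = ci p /\ cj q = (cj p).+1 by apply: RT_at; lia.
  by exists q; [apply/RT_coversP; lia|rewrite qi ltnn].
have [q [qi qj]] : exists q : RT r s, ci q = (ci p).+1 /\ cj q = cj p by apply: RT_at; lia.
by exists q; [apply/RT_coversP; lia|rewrite qi ltnSn].
Qed.

(** Both steps obey the same parameter, and steps in the same direction from the bottom and from the
    top of a square end at opposite corners. *)
Lemma choice_noncrossing p q v : up_choice t p q -> down_choice t q v ->
  ci v = (ci p).+1 -> cj v = (cj p).+1 -> on_left p.
Proof.
move=> /andP[cpq /forallP/(_ v) tv] /andP[cqv tv'] vi vj.
have pv : diag p v by rewrite /diag vi vj !eqxx.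
apply: contraT => pL; have [v1 v2 v3 v4] := RT_bounds v.
have vF : free_dn v by rewrite -(diag_free pv) /free_up pL; lia.
move: tv tv'; rewrite vF pv /= => /eqP -> /eqP eq_t.
move: eq_t; case/RT_coversP: cpq => -[qi qj]; rewrite vi qi ?ltnn ?ltnSn => /eqP.
  by rewrite oner_eq0.
by rewrite eq_sym oner_eq0.
Qed.

(** At most one chain follows a deterministic relation, so the sum is itself an indicator. *)
Lemma sum_steps_in (e : rel (RT r s)) m M : (forall p q, e p q -> covers p q) ->
    {in chains_between m M &, forall C1 C2, steps_in e C1 -> steps_in e C2 -> C1 = C2} ->
  \sum_(C in chains_L m M) (steps_in e C)%:R =
    (`[< exists l, [/\ on_left l, connect e m l & connect e l M] >])%:R :> R.
Proof.
move=> e_cov e_uniq; case: asboolP => [[l [lL ml lM]]|no_l].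
  have [C [CC lC eC]] := (connect_chain_through e_cov m l M).2 (conj ml lM).
  have CL : C \in chains_L m M.
    by rewrite inE CC; apply/pred0Pn; exists l; rewrite /= lC left_borderE.
  rewrite (bigD1 C) //= eC big1 ?addr0 // => C' /andP[]; rewrite inE => /andP[CC' _] neq_C.
  by rewrite (_ : steps_in e C' = false) //; apply: contraNF neq_C => eC'; apply/eqP/e_uniq.
rewrite big1 // => C; rewrite inE => /andP[CC /pred0Pn[l /andP[/= lC]]]; rewrite left_borderE => lL.
rewrite (_ : steps_in e C = false) //; apply/negP=> eC; apply: no_l; exists l.
have [] : connect e m l /\ connect e l M; last by [].
by apply/(connect_chain_through e_cov); exists C.
Qed.

Lemma steps_in_up_unique m M : {in chains_between m M &, forall C1 C2,
  steps_in (up_choice t) C1 -> steps_in (up_choice t) C2 -> C1 = C2}.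
Proof.
suff sub C1 C2 : C1 \in chains_between m M -> C2 \in chains_between m M ->
    steps_in (up_choice t) C1 -> steps_in (up_choice t) C2 -> C1 \subset C2.
  by move=> C1 C2 CC1 CC2 e1 e2; apply/eqP; rewrite eqEsubset !sub.
move=> CC1 CC2 e1 e2; apply/subsetP=> z zC1; have /andP[_ zM] := chain_bounds CC1 zC1.
apply: (chain_up_unique (@up_choice_covers t) up_choice_fun CC2 e2 zM).
suff [] : connect (up_choice t) m z /\ connect (up_choice t) z M by [].
by apply/(connect_chain_through (@up_choice_covers t)); exists C1.
Qed.

Hypothesis r_gt0 : (0 < r)%N.

Lemma down_choice_fun u v y : down_choice t u y -> down_choice t v y -> u = v.
Proof.
move=> /andP[cuy tu] /andP[cvy tv]; have [yF|yF] := boolP (free_dn y); last first.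
  by apply: inhat_inj; apply: (hat_lower_unique r_gt0 yF); rewrite hat_covers.
move: tu tv; rewrite yF /= => /eqP -> /eqP eq_t; apply: (covers_eq_dir cuy cvy).
exact/esym/bool_natr_inj.
Qed.

Lemma down_choice_exists q : ~ (ci q = 1%N /\ cj q = 1%N) -> exists p, down_choice t p q.
Proof.
move=> q11; have [qF|qF] := boolP (free_dn q); last first.
  have [a caq] := hat_lower_exists q r_gt0.
  have [[p eq_a cpq]|[_ ? ?]] := covered_hatP r_gt0 caq; last by case: q11.
  by exists p; rewrite /down_choice cpq (negbTE qF).
case/and3P: (qF) => qi qj /negP qL; have [q1 q2 q3 q4] := RT_bounds q.
rewrite /on_left in qL; case: (t01 q) => tq.
  have [p [pi pj]] : exists p : RT r s, ci p = ci q /\ cj p = (cj q).-1 by apply: RT_at; lia.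
  exists p; rewrite /down_choice tq pi ltnn eqxx implybT andbT.
  by apply/RT_coversP; lia.
have [p [pi pj]] : exists p : RT r s, ci p = (ci q).-1 /\ cj p = cj q by apply: RT_at; lia.
have lt_pq : (ci p < ci q)%N by lia.
exists p; rewrite /down_choice tq lt_pq eqxx implybT andbT.
by apply/RT_coversP; lia.
Qed.

Lemma steps_in_down_unique m M : {in chains_between m M &, forall C1 C2,
  steps_in (down_choice t) C1 -> steps_in (down_choice t) C2 -> C1 = C2}.
Proof.
suff sub C1 C2 : C1 \in chains_between m M -> C2 \in chains_between m M ->
    steps_in (down_choice t) C1 -> steps_in (down_choice t) C2 -> C1 \subset C2.
  by move=> C1 C2 CC1 CC2 e1 e2; apply/eqP; rewrite eqEsubset !sub.
move=> CC1 CC2 e1 e2; apply/subsetP=> z zC1; have /andP[mz _] := chain_bounds CC1 zC1.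
apply: (chain_down_unique (@down_choice_covers t) down_choice_fun CC2 e2 mz).
suff [] : connect (down_choice t) m z /\ connect (down_choice t) z M by [].
by apply/(connect_chain_through (@down_choice_covers t)); exists C1.
Qed.

End ZeroOne.

Lemma sum_factors_duality t m' m M' M : (0 < r)%N ->
    ci m = 1%N -> ci m' = 1%N -> cj m = (cj m').+1 ->
    cj M = s -> cj M' = s -> ci M = (ci M').+1 ->
  \sum_(C in chains_L m M) \prod_v down_factor v C (t v) =
  \sum_(C in chains_L m' M') \prod_v up_factor v C (t v).
Proof.
move=> r_gt0 mi m'i mj Mj M'j Mi; move: t; apply: multiaffine_eq.
- exact/multiaffine_sum_prod/down_factor_affine.
- exact/multiaffine_sum_prod/up_factor_affine.
move=> t t01.
have down_sum := sum_steps_in (@down_choice_covers t) (@steps_in_down_unique t r_gt0 m M).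
have up_sum := sum_steps_in (@up_choice_covers t) (@steps_in_up_unique t m' M').
apply: etrans (etrans _ (esym up_sum)) _; last first.
  by apply: eq_bigr => C; rewrite inE => /andP[CC _]; rewrite (prod_up_factor t01 M'j CC).
apply: etrans (etrans _ down_sum) _.
  by apply: eq_bigr => C; rewrite inE => /andP[CC _]; rewrite (prod_down_factor t01 mi CC).
congr (nat_of_bool _)%:R; apply: asbool_equiv_eq.
apply: through_left_duality => //.
- exact: down_choice_covers.
- exact: up_choice_covers.
- exact: down_choice_exists.
- exact: up_choice_exists.
- exact: choice_noncrossing.
Qed.

End StepFactors.

(** * Telescoping of label products along a chain *)

Section ChainProducts.
Variables (R : realType) (r s : nat) (a : RT r s -> R).
Implicit Types (p q u v y z : RT r s) (C : {set RT r s}) (x w : {ffun RT r s -> R}).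
Local Open Scope ring_scope.
Hypothesis a_gt0 : forall p, 0 < a p.

Definition step_prob : {ffun RT r s -> R} :=
  [ffun v => (\sum_(u | covers u v && (ci u < ci v)%N) a u) / (\sum_(u | covers u v) a u)].

Lemma step_prob_cover y y' v : y != y' -> covers y v -> covers y' v ->
  (if (ci y < ci v)%N then step_prob v else 1 - step_prob v) = a y / (a y + a y').
Proof.
move=> neq_y cy cy'.
have dir_y' : (ci y' < ci v)%N = ~~ (ci y < ci v)%N.
  have : (ci y < ci v)%N <> (ci y' < ci v)%N.
    by move/(covers_eq_dir cy cy')/eqP; rewrite (negbTE neq_y).
  by do 2!case: (_ < _)%N.
have two u : covers u v -> u = y \/ u = y'.
  move=> cu; have [eq_dir|neq_dir] := eqVneq (ci u < ci v)%N (ci y < ci v)%N.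
    by left; apply: covers_eq_dir eq_dir.
  by right; apply: (covers_eq_dir cu cy'); rewrite dir_y'; move: neq_dir; do 2!case: (_ < _)%N.
have sum_all : \sum_(u | covers u v) a u = a y + a y'.
  rewrite (bigD1 y) //= (big_pred1 y') // => u /=.
  apply/andP/eqP=> [[/two[->|//]]|->]; first by rewrite eqxx.
  by rewrite eq_sym.
have pos : a y + a y' != 0 by rewrite gt_eqF // addr_gt0.
rewrite ffunE sum_all; case: ifP dir_y' => lt_y /= dir_y'.
  rewrite (big_pred1 y) // => u /=; apply/andP/eqP=> [[cu lt_u]|->//].
  by apply: (covers_eq_dir cu cy); rewrite lt_y.
rewrite (big_pred1 y') => [|u /=]; first by field.
apply/andP/eqP=> [[cu lt_u]|->//]; by apply: (covers_eq_dir cu cy'); rewrite dir_y'.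
Qed.

Lemma free_dn_other y v : free_dn v -> covers y v ->
  exists y', [/\ y != y', covers y' v & \sum_(u | covers u v) a u = a y + a y'].
Proof.
move=> vF cyv; have [p pv] := free_dn_diagonal vF; have pF : free_up p by rewrite (diag_free pv).
have [q1 [q2 [neq_q c1 c2 q12]]] := diag_middles pv pF.
have sum_eq : \sum_(u | covers u v) a u = a q1 + a q2.
  rewrite (bigD1 q1) -?(diag_covers _ pv) //= (big_pred1 q2) // => u /=.
  rewrite -(diag_covers _ pv); apply/andP/eqP=> [[/q12[->|//]]|->]; first by rewrite eqxx.
  by rewrite eq_sym.
rewrite (diag_covers _ pv) in c1; rewrite (diag_covers _ pv) in c2.
have [eq_y|eq_y] : y = q1 \/ y = q2 by apply: q12; rewrite (diag_covers _ pv).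
  by exists q2; rewrite eq_y.
by exists q1; rewrite eq_y eq_sym sum_eq addrC.
Qed.

(** For a step from [z] down to [y], [x z] is [a z / a y] times the probability of that step, and
    the ratios telescope. At the bottom [x m = a m / a m'], since [m] covers only [m']. *)
Lemma prod_down m m' q x C :
    (0 < r)%N -> ci m = 1%N -> covers m' m ->
    (forall p, (m <= p)%O -> a p = x p * \sum_(y | covers y p) a y) ->
    C \in chains_between m q ->
  \prod_(p in C) x p = a q / a m' * \prod_v down_factor v C (step_prob v).
Proof.
move=> r_gt0 mi cm xP; have a0 p : a p != 0 by rewrite gt_eqF.
have nonfree y z : ~~ free_dn z -> covers y z -> \sum_(u | covers u z) a u = a y.
  move=> zF cyz; rewrite (big_pred1 y) // => u /=; apply/idP/eqP=> [cuz|->//].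
  by apply: inhat_inj; apply: (hat_lower_unique r_gt0 zF); rewrite hat_covers.
move: q C; apply: chain_ind_up => [|y z C CC cyz IH].
  have mF : ~~ free_dn m by rewrite /free_dn mi.
  rewrite big_set1 big1 ?mulr1 => [|v _].
    by rewrite [in RHS](xP m) ?lexx // (nonfree m') // mulfK.
  rewrite /down_factor inE; case: eqP => [->|]; last by rewrite andbF.
  by rewrite (negbTE mF).
have CC' := chain_cons_top CC cyz; set C' := (z |: C)%SET in CC' *.
have lt_yz := covers_lt cyz.
have zC : z \notin C.
  by apply/negP=> /(chain_bounds CC)/andP[_]; rewrite (lt_geF lt_yz).
have mz : (m <= z)%O by have /andP[] := chain_bounds CC' (setU11 z C).
have yC' : y \in C' by rewrite !inE; case/andP: (chain_ends CC) => _ ->; rewrite orbT.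
rewrite big_setU1 //= IH (bigD1 z) //= [in RHS](bigD1 z) //=.
have -> : down_factor z C (step_prob z) = 1 by rewrite /down_factor (negbTE zC) andbF.
(* The new top [z] lies above all of [C], so it is covered by no element of [C] and changes only its
   own factor. *)
have eq_factors : \prod_(v | v != z) down_factor v C' (step_prob v) =
    \prod_(v | v != z) down_factor v C (step_prob v).
  apply: eq_bigr => v neq_vz; rewrite /down_factor inE in_set1 (negbTE neq_vz) /=.
  have [/andP[vF vC]|//] := boolP (free_dn v && (v \in C)).
  congr (if _ then _ else _); apply: eq_existsb => u; rewrite inE in_set1.
  have [-> /=|//] := eqVneq u z; rewrite (negbTE zC) /=.
  apply/negbTE; rewrite negb_and orbC; apply/orP; left.
  apply/negP=> /covers_lt zv; have /andP[_ vy] := chain_bounds CC vC.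
  by move: (lt_trans (lt_le_trans zv vy) lt_yz); rewrite ltxx.
have -> : down_factor z C' (step_prob z) = a y / \sum_(u | covers u z) a u.
  have [zF|zF] := boolP (free_dn z); last by rewrite /down_factor (negbTE zF) (nonfree y) // divff.
  have [y' [neq_y cy'z sum_eq]] := free_dn_other zF cyz.
  rewrite (down_factor_cover _ (chain_comparable CC') yC' (setU11 z C) cyz zF).
  by rewrite (step_prob_cover neq_y cyz cy'z) sum_eq.
rewrite eq_factors mul1r (xP z) // !mulrA; congr (_ * _).
have sum0 : \sum_(u | covers u z) a u != 0.
  by apply: contra_eq_neq (xP z mz) => ->; rewrite mulr0.
by field; rewrite a0 sum0.
Qed.

Lemma prod_up M M' p x C :
    cj M' = s -> covers M' M ->
    (forall q, (q <= M')%O -> (a q)^-1 = x q * \sum_(y | covers q y) (a y)^-1) ->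
    C \in chains_between p M' ->
  \prod_(u in C) x u = a M / a p * \prod_v up_factor v C (step_prob v).
Proof.
move=> Mj cM xP; have a0 q : a q != 0 by rewrite gt_eqF.
have nonfree y z : ~~ free_up y -> covers y z -> \sum_(u | covers y u) (a u)^-1 = (a z)^-1.
  move=> zF cyz; rewrite (big_pred1 z) // => u /=; apply/idP/eqP=> [cuz|->//].
  by apply: inhat_inj; apply: (hat_upper_unique zF); rewrite hat_covers.
move: p C; apply: chain_ind_dn => [|y z C CC cyz IH].
  have MF : ~~ free_up M' by rewrite /free_up Mj ltnn.
  rewrite big_set1 big1 ?mulr1 => [|v _].
    by rewrite [in RHS](xP M') ?lexx // (nonfree M' M) // mulrCA divff ?mulr1.
  rewrite /up_factor; case: ifP => // /andP[vF /existsP[u /andP[]]].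
  rewrite inE => /eqP -> pv; by rewrite (diag_free pv) vF in MF.
have lt_yz := covers_lt cyz.
have yC : y \notin C.
  by apply/negP=> /(chain_bounds CC)/andP[+ _]; rewrite (lt_geF lt_yz).
have /andP[zC MC] := chain_ends CC.
have CC' : (y |: C)%SET \in chains_between y M'.
  have -> : (y |: C = [set y; z] :|: C)%SET.
    by apply/setP=> u; rewrite !inE; case: (eqVneq u z) => [->|]; rewrite ?zC ?orbT ?orbF.
  by apply: chain_join CC; rewrite chains_between_cover // inE.
set C' := (y |: C)%SET in CC' *.
have zC' : z \in C' by rewrite !inE zC orbT.
have yM : (y <= M')%O by have /andP[] := chain_bounds CC' (setU11 y C).
rewrite big_setU1 //= IH.
have same v : ~~ diag y v -> up_factor v C' (step_prob v) = up_factor v C (step_prob v).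
  move=> nyv; rewrite /up_factor.
  have -> : [exists u in C', diag u v] = [exists u in C, diag u v].
    apply: eq_existsb => u; rewrite inE in_set1; have [->|//] := eqVneq u y.
    by rewrite (negbTE nyv) !andbF.
  have [/andP[vF /existsP[p0 /andP[pC p0v]]]|//] := boolP (_ && _).
  congr (if _ then _ else _); apply: eq_existsb => u; rewrite inE in_set1.
  have [->|//] := eqVneq u y; rewrite (negbTE yC) /=; apply/negbTE/negP=> /andP[_ cyv].
  (* If [v] covered [y], then [y] would be a middle corner above [p0], although [p0] lies in [C] and
     hence above [y]. *)
  rewrite -(diag_covers _ p0v) in cyv.
  have /andP[zp _] := chain_bounds CC pC.
  by move: (lt_trans (lt_le_trans lt_yz zp) (covers_lt cyv)); rewrite ltxx.
have [yF|yF] := boolP (free_up y); last first.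
  have -> : \prod_v up_factor v C' (step_prob v) = \prod_v up_factor v C (step_prob v).
    apply: eq_bigr => v _; have [yv|] := boolP (diag y v); last exact: same.
    by rewrite /up_factor -(diag_free yv) (negbTE yF).
  rewrite mulrA; congr (_ * _); rewrite [in RHS](xP y) // (nonfree y z) //.
  by rewrite mulrCA.
have [v yv] := free_up_diagonal yF; have vF : free_dn v by rewrite -(diag_free yv).
rewrite (bigD1 v) //= [in RHS](bigD1 v) //=.
have -> : up_factor v C (step_prob v) = 1.
  rewrite /up_factor; case: ifP => // /andP[_ /existsP[u /andP[uC uv]]].
  by move: yC; rewrite (diag_inj_dn yv uv) uC.
have -> : \prod_(u | u != v) up_factor u C' (step_prob u) =
    \prod_(u | u != v) up_factor u C (step_prob u).
  apply: eq_bigr => u neq_uv; apply: same; apply: contraNN neq_uv => yu.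
  by rewrite (diag_inj_up yu yv).
have czv : covers z v by rewrite -(diag_covers _ yv).
have [z' [neq_z cz'v _]] := free_dn_other vF czv.
have cyz' : covers y z' by rewrite (diag_covers _ yv).
have sum_eq : \sum_(u | covers y u) (a u)^-1 = (a z)^-1 + (a z')^-1.
  rewrite (bigD1 z) //= (big_pred1 z') // => u /=.
  apply/andP/eqP=> [[cyu neq_u]|->]; last by rewrite cyz' eq_sym.
  have [q1 [q2 [neq_q c1 c2 q12]]] := diag_middles yv yF.
  by move: neq_z neq_u; case: (q12 _ cyz) (q12 _ cyz') (q12 _ cyu) => -> [] -> [] ->; rewrite ?eqxx.
(* The step up from [y] to [z] has the direction of the step down from [v] to the opposite corner
   [z']; this is where the reciprocity of the two walks enters. *)
have z'_dir : (ci y < ci z)%N = ~~ (ci z < ci v)%N /\ (ci z' < ci v)%N = ~~ (ci z < ci v)%N.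
  case/andP: (yv) => /eqP vi _.
  case/RT_coversP: (cyz) (cyz') => -[zi zj] /RT_coversP [] [z'i z'j];
    rewrite ?zi ?z'i ?vi ?ltnn ?ltnSn //;
    by case/eqP: neq_z; apply: RT_inj; rewrite ?zi ?zj ?z'i ?z'j.
have -> : up_factor v C' (step_prob v) = a z' / (a z' + a z).
  rewrite (up_factor_cover _ (chain_comparable CC') (setU11 y C) zC' cyz yv vF).
  have neq_z' : z' != z by rewrite eq_sym.
  by rewrite -(step_prob_cover neq_z' cz'v czv) z'_dir.1 z'_dir.2.
rewrite mul1r !mulrA; congr (_ * _); rewrite [in RHS](xP y) // sum_eq.
have : a z' + a z != 0 by rewrite gt_eqF // addr_gt0.
by move=> sum0; field; rewrite !a0 sum0.
Qed.

End ChainProducts.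

(** * Rowmotion combined with the duality of the walks *)

Section Final.
Variables (R : realType) (r s : nat).
Implicit Types (p q : RT r s) (x z : {ffun RT r s -> R}).

Lemma rowmotion_chain_weight_left
    (lam : RT r s -> 'I_#|{: RT r s}|) (laminv : 'I_#|{: RT r s}| -> RT r s)
    (m' m M' M : RT r s) x z :
    (0 < s)%N -> (0 < r)%N -> covers m' m -> covers M' M ->
    ci m = 1%N -> ci m' = 1%N -> cj m = (cj m').+1 ->
    cj M = s -> cj M' = s -> ci M = (ci M').+1 ->
    linear_extension lam laminv -> positive_labeling x -> positive_labeling z ->
    rowmotion laminv z = x ->
  chain_weight (chains_L m M) x = chain_weight (chains_L m' M') z.
Proof.
move=> s_gt0 r_gt0 cm cM mi m'i mj Mj M'j Mi lamP x0 z0 def_x.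
have [b [bi bj]] : exists b : RT r s, ci b = 1%N /\ cj b = 1%N by apply: RT_at; lia.
have [t [ti tj]] : exists t : RT r s, ci t = (r + s - 1)%N /\ cj t = s by apply: RT_at; lia.
have bt p : b <= p <= t.
  by rewrite !RT_leE bi bj ti tj; have [p1 p2 p3 p4] := RT_bounds p; lia.
have WW := rowmotion_chain_weights lamP bt z0 x0 def_x.
have [a aE] : exists a : RT r s -> R, forall p, chain_weight (chains_between b p) x = a p.
  by exists (fun p => chain_weight (chains_between b p) x).
have WWa p : (a p * chain_weight (chains_between p t) z = 1)%R by rewrite -aE; apply: WW.
(* Positivity of [a] follows from the product relation, without exhibiting a chain. *)
have aN0 p : a p != 0%R.
  by apply/eqP=> ap0; have /eqP := WWa p; rewrite ap0 mul0r eq_sym oner_eq0.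
have a_gt0 p : (0 < a p)%R by rewrite lt_neqAle eq_sym aN0 -aE chain_weight_ge0.
have aV p : ((a p)^-1 = chain_weight (chains_between p t) z)%R.
  by apply: (mulfI (aN0 p)); rewrite WWa divff.
have xN0 p : x p != 0%R by rewrite gt_eqF.
have zN0 p : z p != 0%R by rewrite gt_eqF.
(* The recursion fails at the minimum [b], where the sum is empty; being above [m], which covers
   [m'], keeps [p] away from it. *)
have xP p : m <= p -> (a p = x p * \sum_(y | covers y p) a y)%R.
  move=> mp; rewrite -aE; under eq_bigr do rewrite -aE.
  apply: chain_weight_recr => //; rewrite lt_eqF //.
  by apply: le_lt_trans (lt_le_trans (covers_lt cm) mp); case/andP: (bt m').
have zP q : q <= M' -> ((a q)^-1 = z q * \sum_(y | covers q y) (a y)^-1)%R.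
  move=> qM; rewrite aV; under eq_bigr do rewrite aV.
  apply: chain_weight_recl => //; rewrite lt_eqF //.
  by apply: le_lt_trans qM (lt_le_trans (covers_lt cM) _); case/andP: (bt M).
transitivity (a M / a m' * \sum_(C in chains_L m M) \prod_v down_factor v C (step_prob a v))%R.
  rewrite mulr_sumr; apply: eq_bigr => C; rewrite inE => /andP[CC _].
  exact: (prod_down a_gt0 r_gt0 mi cm xP CC).
rewrite (sum_factors_duality _ r_gt0 mi m'i mj Mj M'j Mi) mulr_sumr.
apply: eq_bigr => C; rewrite inE => /andP[CC _].
exact/esym/(prod_up a_gt0 M'j cM zP CC).
Qed.

End Final.

End FiniteSetNames.

Theorem lemma3p19 (R : realType) (r s : nat) (s_gt0 : (0 < s)%N)
    (le_sr : (s <= r)%N) (m' m M' M : RT r s)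
    (cov_m : covers m' m) (cov_M : covers M' M)
    (se_m : se m = set0%classic) (ne_M' : ne M' = set0%classic) :
  ({in up_arb_containing (chains_L m M) &, injective (@aleph R r s)} /\
   (@aleph R r s @: up_arb_containing (chains_L m M))%SET =
     down_arb_containing (chains_L m' M'))
  /\
  (forall (lam : RT r s -> 'I_#|{: RT r s}|) (laminv : 'I_#|{: RT r s}| -> RT r s),
   linear_extension lam laminv ->
   forall x z : {ffun RT r s -> R},
   positive_labeling x -> positive_labeling z ->
   rowmotion laminv z = x ->
   chain_weight (chains_L m M) x = chain_weight (chains_L m' M') z).
Proof.
have r_gt0 : (0 < r)%N by apply: leq_trans le_sr.
have mi := se_empty se_m; have M'j := ne_empty ne_M'.
have [[m1 _ _ _] [_ _ Ms _]] := (RT_bounds m', RT_bounds M).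
(* As [m] already has first coordinate 1, its cover relation with [m'] can only run in direction j;
   likewise the one between [M'] and [M] runs in direction i. *)
have [m'i mj] : ci m' = 1%N /\ cj m = (cj m').+1 by move/RT_coversP: cov_m; lia.
have [Mj Mi] : cj M = s /\ ci M = (ci M').+1 by move/RT_coversP: cov_M; lia.
split; first exact: aleph_restricts.
move=> lam laminv lamP x z x0 z0 def_x.
exact: (rowmotion_chain_weight_left s_gt0 r_gt0 cov_m cov_M mi m'i mj Mj M'j Mi lamP x0 z0 def_x).
Qed.
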